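(* Let $f$ be the map of one of the economic models (1)-(5) listed in the context, for some choice of its parameters, and suppose that $f$ has a hyperbolic compact invariant set $\Lambda$. Then for every dynamical system $g$ obtained from $f$ by a sufficiently small $\mathcal{C}^2$ perturbation of the parameters of $f$ (that is, for every $g$ obtained by changing the parameters of $f$ and sufficiently $\mathcal{C}^2$-close to $f$ on a neighbourhood of $\Lambda$), there exist a $g$-invariant set $\Lambda_g$ and a homeomorphism $H:\hat\Lambda\to\hat\Lambda_g$ such that $\hat g\circ H=H\circ\hat f$. Thus the dynamics of $\hat g$ on $\hat\Lambda_g$ is the same as (topologically conjugate to) the dynamics of $\hat f$ on $\hat\Lambda$.
   Context: Economic models; in each of them $f$ is a (in general non-invertible) map. (1) One-dimensional overlapping generations model: agents work when young and consume when old, maximizing $V_1(\ell_*-\ell_t)+V_2(c_{t+1})$ under the budget constraint $w_t\ell_t=p_{t+1}c_{t+1}$ ($\ell_t$ labour, $c_{t+1}$ future consumption, $\ell_*$ fixed labour endowment, $w_t$ wage, $p_{t+1}$ expected price). The solution is expressed by an offer curve, $\ell_t=\chi(c_{t+1})$, and since $\ell_t=c_t$ one gets $y_t=\chi(y_{t+1})$. Here $f=\chi$, an interval map, in many cases a smooth unimodal map (including the logistic maps $x\mapsto\nu x(1-x)$, $\nu>4$). (2) Two-dimensional overlapping generations model: with an offer curve $\chi$ as in (1), $a>0$ and $0<\delta<1$, the map is $f(z,w)=\left(\chi\left[a\left(1-\delta+\tfrac1a\right)z-aw\right],\,z\right)$, and the model is $(z_t,w_t)=f(z_{t+1},w_{t+1})$.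 (3) Cash-in-advance model: an agent maximizes $\sum_{t\ge0}\beta^tU(c_{1t},c_{2t})$, $\beta\in(0,1)$, $U(x,y)=\frac{x^{1-\sigma}}{1-\sigma}+\frac{y^{1-\gamma}}{1-\gamma}$, $\sigma,\gamma>0$, over $\{c_{1t},c_{2t},m_{t+1}\}_{t\ge0}$ subject to $p_tc_{1t}\le m_t$ and $m_{t+1}\le p_ty+(m_t-p_tc_{1t})+\theta M_t-p_tc_{2t}$, where $y$ is the endowment in each period, $c_{1t}+c_{2t}=y$, and the money supply satisfies $M_{t+1}=(1+\theta)M_t$. With $x_t=m_t/p_t$ the level of real money balance, one obtains a difference equation $x_t=f(x_{t+1})$ with a non-invertible one-variable map $f$; this is the map of the model. (4) Cobweb model with adaptive adjustment: $f(z)=f_{\alpha,\beta}(z)=(1-\alpha)z+\frac{\alpha}{z^\beta}$, $(\alpha,\beta)\in(0,1)\times(0,\infty)$, $z>0$. (5) Heterogeneous market model: $f(z,m)=\left(z\left[(1-\alpha)-\alpha\tfrac{b(1-m)}{2B}\right],\ \tanh\left[\tfrac{\beta b}{4}z^2\left(\tfrac{b(1-m)}{B}+1\right)+\tfrac\beta2(C_2-C_1)\right]\right)$ with real parameters $\alpha,\beta,b,B,C_1,C_2$. Inverse limits. A set $\Lambda$ is $f$-invariant if $f(\Lambda)=\Lambda$. The inverse limit of $(\Lambda,f)$ is $\hat\Lambda=\{\hat x=(x,x_{-1},x_{-2},\ldots):\ x_{-i}\in\Lambda,\ f(x_{-i})=x_{-i+1},\ i\ge1\}$ (with $x_0=x$),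 with the shift homeomorphism $\hat f(x,x_{-1},\ldots)=(f(x),x,x_{-1},\ldots)$ and the metric $d(\hat x,\hat y)=\sum_{i\ge0}\frac{d(x_{-i},y_{-i})}{2^i}$. Similarly $\hat\Lambda_g,\hat g$ are the inverse limit and shift for $(\Lambda_g,g)$. Hyperbolicity (in the endomorphism sense). $f$, smooth ($\mathcal{C}^2$) near the compact invariant set $\Lambda$, is hyperbolic on $\Lambda$ if over $\hat\Lambda$ there is a continuous splitting of the tangent spaces $T_x=E^s_x\oplus E^u_{\hat x}$, $\hat x\in\hat\Lambda$, with $Df(E^s_x)\subset E^s_{f(x)}$, $Df(E^u_{\hat x})=E^u_{\hat f\hat x}$, and constants $C>0$, $0<\lambda<1$ such that $|Df^n v|\le C\lambda^n|v|$ for $v\in E^s_x$ and $|Df^nv|\ge C^{-1}\lambda^{-n}|v|$ for $v\in E^u_{\hat x}$, $n\ge 0$; unstable directions may depend on the whole prehistory $\hat x$. The case without contracting directions (the expanding case) is included. *)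

(* Defs.v *)
From HB Require Import structures.
From mathcomp Require Import all_boot all_order all_algebra.
From mathcomp Require Import all_classical all_reals all_analysis.
Set Implicit Arguments.
Unset Strict Implicit.
Unset Printing Implicit Defensive.
Import Order.TTheory GRing.Theory Num.Theory.
Import numFieldNormedType.Exports.
Local Open Scope classical_set_scope.
Local Open Scope ring_scope.

Section InverseLimits.
Context {R : realType} {T : normedModType R}.
Implicit Types (f : T -> T) (L : set T) (x y : nat -> T).

Definition invariant_set f L : Prop := f @` L = L.

(* A prehistory (x, x_{-1}, x_{-2}, ...) is encoded by [x i] = x_{-i}. *)
Definition inverse_limit f L : set (nat -> T) :=
  [set x | forall i, L (x i) /\ f (x i.+1) = x i].

Definition hat_shift f x : nat -> T := fun i => if i is j.+1 then x j else f (x 0).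

(* Extended-real valued, so that the series needs no convergence hypothesis;
   it is finite between prehistories in a bounded set. *)
Definition hat_dist x y : \bar R :=
  (\sum_(0 <= i <oo) (`|x i - y i| / 2 ^+ i)%:E)%E.

Definition hat_continuous (A : set (nat -> T)) (F : (nat -> T) -> T) : Prop :=
  forall x, A x -> forall e : R, 0 < e -> exists2 r : R, 0 < r &
    forall y, A y -> (hat_dist x y < r%:E)%E -> `|F x - F y| < e.

Definition hat_continuous_map (A : set (nat -> T))
    (F : (nat -> T) -> (nat -> T)) : Prop :=
  forall x, A x -> forall e : R, 0 < e -> exists2 r : R, 0 < r &
    forall y, A y -> (hat_dist x y < r%:E)%E ->
      (hat_dist (F x) (F y) < e%:E)%E.

Definition hat_homeomorphism (A B : set (nat -> T))
    (H : (nat -> T) -> (nat -> T)) : Prop :=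
  exists K : (nat -> T) -> (nat -> T),
    [/\ (forall x, A x -> B (H x) /\ K (H x) = x),
        (forall y, B y -> A (K y) /\ H (K y) = y),
        hat_continuous_map A H &
        hat_continuous_map B K].

End InverseLimits.

Section SmoothMaps.
Context {R : realType} {T : normedModType R}.
Implicit Types (f g : T -> T) (U : set T).

(* The second derivative at [x], applied to [v] and then to [w]. *)
Definition diff2 f (x v w : T) : T := 'd (fun y : T => 'd f y v) x w.

(* [U] is meant to be open.  On the finite-dimensional spaces [R] and [R * R]
   this directionwise formulation is the usual class C^2. *)
Definition C2_on U f : Prop :=
  forall x, U x ->
    [/\ differentiable f x,
        (forall v : T, differentiable (fun y : T => 'd f y v) x) &
        (forall v w : T, {for x, continuous (fun y : T => diff2 f y v w)})].

Definition C2_close U (e : R) f g : Prop :=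
  forall x, U x ->
    [/\ `|f x - g x| <= e,
        (forall v : T, `|'d f x v - 'd g x v| <= e * `|v|) &
        (forall v w : T, `|diff2 f x v w - diff2 g x v w| <= e * `|v| * `|w|)].

End SmoothMaps.

Section Hyperbolicity.
Context {R : realType} {T : normedModType R}.

Definition linear_subspace (E : set T) : Prop :=
  E 0 /\ forall (a : R) (u v : T), E u -> E v -> E (a *: u + v).

(* [Es x] is the stable space at the point [x]; [Eu x] is the unstable space at
   the base point [x 0] of the prehistory [x].  All tangent spaces are [T]. *)
Record hyperbolic_splitting (f : T -> T) (L : set T)
    (Es : T -> set T) (Eu : (nat -> T) -> set T) : Prop := {
  stable_subspace : forall x, L x -> linear_subspace (Es x);
  unstable_subspace :
    forall x, inverse_limit f L x -> linear_subspace (Eu x);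
  splitting_direct :
    forall x, inverse_limit f L x -> Es (x 0) `&` Eu x = [set 0];
  (* The sum is the whole tangent space, and the two projections of each fixed
     vector vary continuously with the prehistory. *)
  splitting_continuous :
    forall v : T, exists2 s : (nat -> T) -> T,
      hat_continuous (inverse_limit f L) s &
      forall x, inverse_limit f L x -> Es (x 0) (s x) /\ Eu x (v - s x);
  stable_invariant : forall x, L x -> 'd f x @` Es x `<=` Es (f x);
  unstable_invariant :
    forall x, inverse_limit f L x -> 'd f (x 0) @` Eu x = Eu (hat_shift f x);
  hyperbolic_rates :
    exists C lam : R, [/\ 0 < C, 0 < lam, lam < 1,
      (forall x v n, L x -> Es x v ->
         `|'d (iter n f) x v| <= C * lam ^+ n * `|v|) &
      (forall x v n, inverse_limit f L x -> Eu x v ->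
         C^-1 * lam ^- n * `|v| <= `|'d (iter n f) (x 0) v|)]
}.

Definition hyperbolic_set (f : T -> T) (L : set T) : Prop :=
  [/\ compact L, invariant_set f L,
      (exists U : set T, [/\ open U, L `<=` U & C2_on U f]) &
      exists Es Eu, hyperbolic_splitting f L Es Eu].

End Hyperbolicity.

Section EconomicMaps.
Context {R : realType}.

(* (labour, future consumption) pairs allowed by the budget constraint.  The
   inequalities are strict because utilities need not be finite at the ends. *)
Definition budget_set (lstar w p : R) : set (R * R) :=
  [set lc | [/\ 0 < lc.1, lc.1 < lstar, 0 < lc.2 & w * lc.1 = p * lc.2]].

Definition optimal_choice (V1 V2 : R -> R) (lstar w p : R) : set (R * R) :=
  [set lc | budget_set lstar w p lc /\
    forall lc', budget_set lstar w p lc' ->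
      V1 (lstar - lc'.1) + V2 lc'.2 <= V1 (lstar - lc.1) + V2 lc.2].

(* Every solution of the agent's problem lies on the graph of [chi], and a
   nontrivial arc of the graph consists of solutions.  Outside the consumption
   levels that occur as solutions, [chi] is an arbitrary extension: the map has
   to be defined around the endpoints of the interval (such as 0 and 1 for
   logistic maps), which may belong to an invariant set. *)
Definition offer_curve (V1 V2 : R -> R) (lstar : R) (chi : R -> R) : Prop :=
  (forall w p l c, 0 < w -> 0 < p ->
     optimal_choice V1 V2 lstar w p (l, c) -> l = chi c) /\
  (exists a b : R, a < b /\ forall c, a < c -> c < b ->
     exists w p, [/\ 0 < w, 0 < p &
       optimal_choice V1 V2 lstar w p (chi c, c)]).

Definition olg1_maps : set (R -> R) :=
  [set chi | exists V1 V2 lstar, 0 < lstar /\ offer_curve V1 V2 lstar chi].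

Definition olg2_maps : set (R * R -> R * R) :=
  [set f | exists (chi : R -> R) (a delta : R),
    [/\ olg1_maps chi, 0 < a, 0 < delta, delta < 1 &
        f = fun zw => (chi (a * (1 - delta + a^-1) * zw.1 - a * zw.2), zw.1)]].

(* With multipliers lambda_t (budget) and mu_t (cash-in-advance), the first
   order conditions are
     c1^(-sigma) = p (lambda + mu),   c2^(-gamma) = p lambda,
     lambda_t = beta (lambda_{t+1} + mu_{t+1}),
   where either mu_t = 0 or p_t c1_t = m_t.  Put m_t = M_t, c1_t + c2_t = y and
   x_t = m_t / p_t.  Then c1_t = min (x_t, c), where c equates the two marginal
   utilities, and eliminating the multipliers gives A (x_t) = B (x_{t+1}) with
   A and B as below.  A is an increasing bijection of ]0, +oo[, so that
   x_t = f (x_{t+1}) for f = A^-1 o B. *)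
Definition cia_A (gamma y c x : R) : R :=
  x * (y - Num.min x c) `^ (- gamma).

Definition cia_B (beta theta sigma c x : R) : R :=
  beta / (1 + theta) * x * (Num.min x c) `^ (- sigma).

(* Only the values of [f] on ]0, +oo[ are constrained. *)
Definition cia_maps : set (R -> R) :=
  [set f | exists beta sigma gamma y theta : R,
    [/\ 0 < beta < 1, 0 < sigma, 0 < gamma, 0 < y & 0 < 1 + theta] /\
    exists c : R,
      [/\ 0 < c, c < y, c `^ (- sigma) = (y - c) `^ (- gamma) &
          forall x, 0 < x ->
            0 < f x /\ cia_A gamma y c (f x) = cia_B beta theta sigma c x]].

Definition cobweb_maps : set (R -> R) :=
  [set f | exists alpha beta : R,
    [/\ 0 < alpha, alpha < 1, 0 < beta &
        forall z, 0 < z -> f z = (1 - alpha) * z + alpha / z `^ beta]].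

Definition tanh (x : R) : R :=
  (expR x - expR (- x)) / (expR x + expR (- x)).

Definition hmm_maps : set (R * R -> R * R) :=
  [set f | exists alpha beta b B C1 C2 : R, B != 0 /\
    f = fun zm =>
      (zm.1 * ((1 - alpha) - alpha * (b * (1 - zm.2) / (2 * B))),
       tanh (beta * b / 4 * zm.1 ^+ 2 * (b * (1 - zm.2) / B + 1)
             + beta / 2 * (C2 - C1)))].

End EconomicMaps.

Inductive economic_model : Type :=
  OLG1 | OLG2 | CashInAdvance | Cobweb | HeterogeneousMarket.

(* [R * R] carries the sup norm. *)
Definition state (R : realType) (m : economic_model) : normedModType R :=
  match m with
  | OLG1 | CashInAdvance | Cobweb => R^o
  | OLG2 | HeterogeneousMarket => (R^o * R^o)%type
  end.

Definition model_domain (R : realType) (m : economic_model) :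
    set (state R m) :=
  match m return set (state R m) with
  | OLG1 => [set: R]
  | OLG2 => [set: R * R]
  | CashInAdvance => [set x : R | 0 < x]
  | Cobweb => [set z : R | 0 < z]
  | HeterogeneousMarket => [set: R * R]
  end.

(* All maps of the model, for all admissible values of its parameters; the
   utility functions, hence the offer curve, are among the parameters. *)
Definition model_maps (R : realType) (m : economic_model) :
    set (state R m -> state R m) :=
  match m return set (state R m -> state R m) with
  | OLG1 => @olg1_maps R
  | OLG2 => @olg2_maps R
  | CashInAdvance => @cia_maps R
  | Cobweb => @cobweb_maps R
  | HeterogeneousMarket => @hmm_maps R
  end.

Arguments model_domain R m : clear implicits.
Arguments model_maps R m : clear implicits.

(* Main.v *)
Require Import Defs.
From mathcomp Require Import all_boot all_order all_algebra.
From mathcomp Require Import all_classical all_reals all_analysis.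
From mathcomp Require Import ring lra.
Set Implicit Arguments.
Unset Strict Implicit.
Unset Printing Implicit Defensive.
Import Order.TTheory GRing.Theory Num.Theory.
Import numFieldNormedType.Exports.
Local Open Scope classical_set_scope.
Local Open Scope ring_scope.

(** Stability is proved for a hyperbolic set [L] of a map [f] of any
    finite-dimensional normed space; the state spaces of the models are the
    line and the plane.

    A point [x] of the inverse limit of [L] is a whole orbit
    [..., x 1, x 0, f (x 0), ...] of [f].  Its conjugate is to be an orbit of
    [g] that stays close to it.  Writing the latter as orbit plus correction
    [u], and letting [u] depend on [x], the equation to be solved is
    [g (x 0 + u x) = f (x 0) + u (hat_shift f x)].  Its linear part is
    [u (hat_shift f x) - 'd f (x 0) (u x)], which hyperbolicity makes
    invertible: the stable component of the right-hand side is propagated from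
    the past by the derivative, and the unstable component is pulled back from
    the future.  The two families of operators which do this form a Green kernel
    ([hyperbolic_green_kernel]).  Truncating the sums to finitely many terms
    gives an approximate inverse, accurate enough for Newton's method to
    converge ([shadowing_map]).  The result is a map [phi] from the inverse
    limit to the state space, close to [x |-> x 0], with
    [g (phi x) = phi (hat_shift f x)].  The invariant set of [g] is the image of
    [phi], and the conjugacy [H] applies [phi] at every time of the prehistory.

    The same kernel bounds a bounded almost-orbit of the derivative by its size
    at the two ends of a time window ([green_a_priori]).  Hence two orbits
    that both follow one hyperbolic orbit during a long window are
    exponentially close in the middle of it ([tracking_contraction]).  For
    orbits of [g] this is the continuity of [H]; for orbits of [f] it is the
    injectivity of [H] and the continuity of its inverse.

    Surjectivity needs care, because a prehistory in the image of [phi] is built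
    from points that come from unrelated prehistories in [L], and because [L]
    need not contain every orbit of [f] that stays near it.  But the [i]-th
    point already has a conjugate agreeing with the given prehistory up to time
    [i]; by the contraction estimate these form a Cauchy sequence, and [L] is
    closed ([conjugacy_surj]). *)

(** * Prehistories and their shift *)

Section Prehistories.
Context {R : realType} {T : normedModType R}.
Implicit Types (f : T -> T) (L : set T) (x : nat -> T).

Definition unshift x : nat -> T := fun i => x i.+1.

Lemma iter_unshift n x i : iter n unshift x i = x (n + i)%N.
Proof. by elim: n i => //= n IH i; rewrite /unshift IH addnS. Qed.

Lemma iter_hat_shift0 f n x : iter n (hat_shift f) x 0%N = iter n f (x 0%N).
Proof. by elim: n => //= n ->. Qed.

Lemma iter_prehistory f x : (forall i, f (x i.+1) = x i) ->
  forall n i, iter n f (x (n + i)%N) = x i.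
Proof. by move=> fx; elim=> // n IH i; rewrite iterSr addSn fx. Qed.

Lemma hat_shiftK f : cancel (hat_shift f) unshift.
Proof. by []. Qed.

(** Together with [hat_shiftK]: the shift is invertible on the inverse limit
    although [f] need not be. *)
Lemma unshiftK f L x : inverse_limit f L x -> hat_shift f (unshift x) = x.
Proof. by move=> Lx; apply/funext => -[|i] //=; case: (Lx 0%N). Qed.

Lemma inverse_limit_unshift f L x :
  inverse_limit f L x -> inverse_limit f L (unshift x).
Proof. by move=> Lx i; exact: Lx. Qed.

Lemma inverse_limit_iter_unshift f L n x :
  inverse_limit f L x -> inverse_limit f L (iter n unshift x).
Proof. by move=> Lx; elim: n => //= n /inverse_limit_unshift. Qed.

Lemma invariant_iter f L n y : invariant_set f L -> L y -> L (iter n f y).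
Proof. by move=> fL Ly; elim: n => //= n IH; rewrite -fL;
  exists (iter n f y). Qed.

Lemma inverse_limit_shift f L x : invariant_set f L ->
  inverse_limit f L x -> inverse_limit f L (hat_shift f x).
Proof.
move=> fL Lx; have [Lx0 _] := Lx 0%N.
by case=> [|i] //=; split=> //; exact: (@invariant_iter f L 1).
Qed.

Lemma inverse_limit_iter_shift f L n x : invariant_set f L ->
  inverse_limit f L x -> inverse_limit f L (iter n (hat_shift f) x).
Proof. by move=> fL Lx; elim: n => //= n /(inverse_limit_shift fL). Qed.

End Prehistories.

(** * Calculus in finite dimension *)

Section FiniteDimension.
Context {R : realType}.

(** Coordinates are required to be continuous, so that boundedness, completeness
    and mean values can be read off from those of the real line. *)
Definition finite_dimensional (T : normedModType R) : Prop :=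
  exists n (e : 'I_n -> T) (c : 'I_n -> {linear T -> R^o}),
    (forall v, v = \sum_i (c i v : R) *: e i) /\ (forall i, continuous (c i)).

Lemma finite_dimensional_line : finite_dimensional (R^o : normedModType R).
Proof.
exists 1%N, (fun=> 1), (fun=> idfun : {linear R^o -> R^o}); split=> [v|i v].
  by rewrite big_ord1 /= /GRing.scale /= mulr1.
exact.
Qed.

Lemma finite_dimensional_plane :
  finite_dimensional ((R^o * R^o)%type : normedModType R).
Proof.
exists 2%N, (fun i => if i == 0 then (1, 0) else (0, 1)),
  (fun i => if i == 0 then (fst : {linear (R^o * R^o)%type -> R^o})
            else (snd : {linear (R^o * R^o)%type -> R^o})).
split=> [[a b]|i].
  rewrite big_ord_recl big_ord1 /=; congr (_, _) => /=.
    by rewrite /GRing.scale /= mulr1 mulr0 addr0.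
  by rewrite /GRing.scale /= mulr1 mulr0 add0r.
by case: (i == 0) => z; [exact: cvg_fst|exact: cvg_snd].
Qed.

Lemma coordinate_bounds (T : normedModType R) n (c : 'I_n -> {linear T -> R^o})
  :
  (forall i, continuous (c i)) ->
  exists k : 'I_n -> R, forall i, 0 < k i /\ forall v, `|c i v| <= k i * `|v|.
Proof.
move=> ccont; have [i|k kP] := @choice _ R (fun i (l : R) =>
  0 < l /\ forall v, `|c i v| <= l * `|v|); last by exists k.
by have [l] := linear_lipschitz (ccont i); exists l.
Qed.

Section Consequences.
Variables (T : normedModType R) (fdT : finite_dimensional T).

Lemma finite_dimensional_complete (u : nat -> T) :
  cauchy (u @ \oo) -> cvg (u @ \oo).
Proof.
move=> cu; have [n [e [c [ceE ccont]]]] := fdT.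
have cvc i : cvg ((c i \o u) @ \oo).
  apply/cauchy_cvgP/cauchy_ballP => d d0.
  have [k k0 ck] := linear_lipschitz (ccont i).
  have dk : 0 < d / k by rewrite divr_gt0.
  move/cauchy_ballP/(_ _ dk): cu.
  rewrite !near_map2; apply: filterS => -[a b] /=.
  rewrite -!ball_normE /= => ab; rewrite -linearB.
  by rewrite (le_lt_trans (ck _))// mulrC -ltr_pdivlMr.
have [l ul] := choice (fun i => iffLR (cvg_ex _) (cvc i)).
apply/cvg_ex; exists (\sum_i (l i : R) *: e i).
rewrite (funext (fun j => ceE (u j)) : u = _).
apply: cvg_big => [|i _]; first exact: add_continuous.
exact: (@cvgZr_tmp R T nat \oo _ (fun j => (c i (u j) : R)) _ (e i) (ul i)).
Qed.

(** Pointwise smallness of linear maps is smallness in operator norm, since it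
    suffices to test the finitely many basis vectors. *)
Lemma near_operator_norm (I : Type) (F : set_system I) {FF : Filter F}
    (A : I -> {linear T -> T}) :
  (forall v d, 0 < d -> \forall t \near F, `|A t v| <= d) ->
  forall d, 0 < d -> \forall t \near F, forall v, `|A t v| <= d * `|v|.
Proof.
move=> A0 d d0; have [n [e [c [ceE ccont]]]] := fdT.
have [k kP] := coordinate_bounds ccont.
pose K := \sum_i k i + 1.
have K0 : 0 < K.
  by rewrite ltr_wpDl// sumr_ge0// => i _; have [/ltW] := kP i.
have : \forall t \near F, forall i, `|A t (e i)| <= d / K.
  by apply: filter_forall => i; apply: A0; rewrite divr_gt0.
apply: filterS => t At v.
rewrite {1}(ceE v) linear_sum (le_trans (ler_norm_sum _ _ _))//.
have : \sum_i (k i * `|v|) * (d / K) <= d * `|v|.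
  rewrite -!mulr_suml -mulrA [`|v| * _]mulrC mulrA ler_wpM2r//.
  by rewrite mulrCA ler_piMr ?(ltW d0)// ler_pdivrMr// mul1r /K lerDl.
apply: le_trans; apply: ler_sum => i _.
rewrite linearZ normrZ; apply: ler_pM => //.
by have [_] := kP i; exact.
Qed.

(** The real mean value theorem is applied to each coordinate separately, each
    with its own intermediate point; the constant [K] is the price of adding
    up the coordinates. *)
Lemma mean_value_inequality : exists2 K : R, 0 < K &
  forall (F : T -> T) (a b : T) (k : R),
    (forall t, 0 <= t <= 1 -> let z := b + t *: (a - b) in
       differentiable F z /\ forall v, `|'d F z v| <= k * `|v|) ->
    `|F a - F b| <= K * (k * `|a - b|).
Proof.
have [n [e [c [ceE ccont]]]] := fdT.
have [k kP] := coordinate_bounds ccont.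
pose K := \sum_i k i * `|e i| + 1.
have K0 : 0 < K.
  rewrite ltr_wpDl// sumr_ge0// => i _.
  by have [/ltW k0 _] := kP i; rewrite mulr_ge0.
exists K => // F a b l hF.
pose z t := b + t *: (a - b).
have l0 : 0 <= l * `|a - b|.
  have [|_ dF] := hF 0; first by rewrite lexx ler01.
  by rewrite (le_trans _ (dF (a - b))).
have cF i : `|c i (F a - F b)| <= k i * (l * `|a - b|).
  pose phi : R -> R := c i \o (F \o z).
  have dphi (t : R) : 0 <= t <= 1 -> is_derive t (1 : R) phi (c i ('d F (z t)
    (a - b))).
    move=> t01; have [Fz _] := hF t t01.
    have dz : is_diff t z (cst 0 + *:%R^~ (a - b)) by apply: is_diffD.
    have dc : is_diff (F (z t)) (c i) (c i).
      by apply: DiffDef; [exact: linear_differentiable|exact: diff_lin].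
    have /differentiableP dFz := Fz.
    have : is_diff t phi (c i \o ('d F (z t) \o (cst 0 + *:%R^~ (a - b)))).
      by apply: is_diff_comp.
    move=> dp; have dp1 : differentiable phi t by exact: ex_diff.
    apply: DeriveDef; first exact/diff_derivable.
    rewrite deriveE// diff_val /=.
    by rewrite /GRing.add /= /cst /= add0r scale1r.
  have [||t t01] := @MVT_segment R phi (fun t => c i ('d F (z t) (a - b))) 0 1
    ler01.
  - by move=> t; rewrite in_itv /= => /andP[t0 t1]; apply: dphi; rewrite !ltW.
  - apply: derivable_within_continuous => t; rewrite in_itv /= => t01.
    by have [] := dphi t t01.
  rewrite subr0 mulr1 /phi /= /z scale1r scale0r addr0 subrKC -linearB => ->.
  have [k0 ck] := kP i; apply: (le_trans (ck _)); rewrite ler_wpM2l ?(ltW k0)//.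
  have [|_] := hF t; first by move: t01; rewrite in_itv.
  exact.
rewrite {1}(ceE (F a - F b)) (le_trans (ler_norm_sum _ _ _))//.
have : \sum_i (k i * `|e i|) * (l * `|a - b|) <= K * (l * `|a - b|).
  by rewrite -mulr_suml ler_wpM2r// /K lerDl.
apply: le_trans; apply: ler_sum => i _.
by rewrite normrZ mulrAC ler_wpM2r.
Qed.

End Consequences.
End FiniteDimension.

(** * Uniform linear approximation near a compact set *)

Section LocalEstimates.
Context {R : realType} {T : normedModType R}.
Hypothesis fdT : finite_dimensional T.
Variables (f : T -> T) (L U : set T).
Hypotheses (cL : compact L) (oU : open U) (LU : L `<=` U) (fU : C2_on U f).

Lemma near_diff x d : U x -> 0 < d ->
  \forall y \near x, forall v, `|'d f y v - 'd f x v| <= d * `|v|.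
Proof.
move=> Ux; move: d; apply: (@near_operator_norm _ _ fdT _ (nbhs x) _
  (fun y => ('d f y \- 'd f x)%R : {linear T -> T})) => v d d0.
have [_ /(_ v)/differentiable_continuous dfv _] := fU Ux.
move/cvgrPdist_le/(_ _ d0): dfv; apply: filterS => y /=.
by rewrite distrC.
Qed.

Lemma diff_bounded :
  exists2 M : R, 0 < M & forall x v, L x -> `|'d f x v| <= M * `|v|.
Proof.
move/compact_near_coveringP: cL => /(_ R (+oo%R : set_system R)
  (fun M x => forall v, `|'d f x v| <= M * `|v|)) [|M [_ MP]].
- move=> x Lx; have Ux := LU Lx; have [dfx _ _] := fU Ux.
  have [k k0 kP] := linear_lipschitz (diff_continuous dfx).
  exists ([set z | forall v, `|'d f z v - 'd f x v| <= 1 * `|v|],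
    [set M | 1 + k <= M]).
    split=> /=; first exact: near_diff.
    by apply: nbhs_pinfty_ge; exact: num_real.
  move=> [z M] /= [zx kM] v.
  rewrite -[X in `|X|](subrK ('d f x v)) (le_trans (ler_normD _ _))//.
  by rewrite (le_trans (lerD (zx v) (kP v)))// -mulrDl ler_wpM2r.
- exists (Num.max M 0 + 1); first by rewrite ltr_wpDl// le_max lexx orbT.
  move=> x v Lx; apply: MP Lx v.
  by rewrite (le_lt_trans (_ : _ <= Num.max M 0))// ?le_max ?lexx// ltrDl.
Qed.

Lemma uniform_near_diff d : 0 < d -> exists2 r : R, 0 < r &
  forall x y, L x -> `|y - x| < r ->
    U y /\ forall v, `|'d f y v - 'd f x v| <= d * `|v|.
Proof.
move=> d0; move/compact_near_coveringP: cL => /(_ R (0 : R)^'+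
  (fun r x => forall y, `|y - x| < r ->
    U y /\ forall v, `|'d f y v - 'd f x v| <= d * `|v|)) [|e /= e0 eP].
- move=> x Lx; have Ux := LU Lx.
  have d20 : 0 < d / 2 by rewrite divr_gt0.
  have : \forall y \near x, U y /\
      forall v, `|'d f y v - 'd f x v| <= (d / 2) * `|v|.
    by apply: filterI; [exact: open_nbhs_nbhs|exact: near_diff].
  move=> /nbhs_ballP[s /= s0 sP].
  have s20 : 0 < s / 2 by rewrite divr_gt0.
  near=> z r => /= y yz.
  have zx : ball x (s / 2) z by near: z; exact: nbhsx_ballx.
  have rs : r < s / 2 by near: r; exact: nbhs_right_lt.
  have [Uy yP] : U y /\ forall v, `|'d f y v - 'd f x v| <= (d / 2) * `|v|.
    apply: sP; apply: (@ball_splitl _ _ z) => //.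
    by rewrite -ball_normE; exact: lt_trans yz rs.
  have [_ zP] : U z /\ forall v, `|'d f z v - 'd f x v| <= (d / 2) * `|v|.
    apply: sP; apply: (le_ball _ zx); lra.
  split=> // v; rewrite [d](splitr) mulrDl.
  rewrite (le_trans _ (lerD (yP v) (zP v)))// [X in _ <= _ + X]distrC.
  exact: ler_distD.
- have e20 : 0 < e / 2 by rewrite divr_gt0.
  exists (e / 2) => // x y Lx; apply: eP Lx _ => //=.
  by rewrite sub0r normrN gtr0_norm// ltr_pdivrMr// ltr_pMr// ltr1n.
Unshelve. all: by end_near. Qed.

(** The derivative of [g - 'd f x] is small near [x]: half of [d] pays for the
    oscillation of ['d f], the other half for the distance from [f] to [g].
    The mean value inequality turns this into a Lipschitz bound.  Neither the
    radius nor the closeness depends on [g], so that the same window serves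
    [f] and all of its perturbations. *)
Lemma local_linear_estimate d : 0 < d -> exists2 r : R, 0 < r &
  (forall x y, L x -> `|y - x| < r -> U y) /\
  exists2 e : R, 0 < e & forall g : T -> T,
    (forall y, U y -> differentiable g y /\
       forall v, `|'d f y v - 'd g y v| <= e * `|v|) ->
    forall x y z, L x -> `|y - x| < r -> `|z - x| < r ->
      `|g y - g z - 'd f x (y - z)| <= d * `|y - z|.
Proof.
move=> d0; have [K K0 mvt] := mean_value_inequality fdT.
have e0 : 0 < d / K / 2 by rewrite !divr_gt0.
have [r r0 rP] := uniform_near_diff e0.
exists r => //; split=> [x y Lx xy|]; first by have [] := rP x y Lx xy.
exists (d / K / 2) => // g gP x y z Lx xy xz.
have [dfx _ _] := fU (LU Lx).
have dAx : continuous ('d f x) := diff_continuous dfx.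
pose F := g - ('d f x : T -> T).
have -> : g y - g z - 'd f x (y - z) = F y - F z.
  by rewrite /F linearB !opprD !opprK addrACA.
have -> : d * `|y - z| = K * (d / K * `|y - z|).
  by rewrite mulrA mulrCA divff ?mulr1// gt_eqF.
apply: mvt => t /andP[t0 t1] /=; set w := z + _.
have xw : `|w - x| < r.
  have -> : w - x = (1 - t) *: (z - x) + t *: (y - x).
    rewrite [RHS]addrC scalerBl scale1r addrCA -scalerBr opprB.
    by rewrite [y - x + _]addrA subrK /w addrAC.
  rewrite (le_lt_trans (ler_normD _ _))// !normrZ (ger0_norm t0).
  rewrite ger0_norm ?subr_ge0//.
  have [->|t0'] := eqVneq t 0; first by rewrite subr0 mul1r mul0r addr0.
  have -> : r = (1 - t) * r + t * r by ring.
  rewrite ler_ltD//.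
    by rewrite ler_wpM2l ?subr_ge0// ltW.
  by rewrite ltr_pM2l// lt_neqAle eq_sym t0'.
have [Uw wP] := rP x w Lx xw; have [dgw gw] := gP w Uw.
have dA : differentiable ('d f x) w by exact: linear_differentiable.
split=> [|v]; first exact: differentiableB.
have -> : 'd F w v = 'd g w v - 'd f x v.
  rewrite -[in RHS](diff_lin w dAx).
  exact: (congr1 (fun h : T -> T => h v) (diffB dgw dA)).
have -> : d / K * `|v| = d / K / 2 * `|v| + d / K / 2 * `|v|.
  by rewrite -mulrDl -splitr.
have gw' : `|'d g w v - 'd f w v| <= d / K / 2 * `|v| by rewrite distrC.
exact: le_trans (ler_distD ('d f w v) _ _) (lerD gw' (wP v)).
Qed.

End LocalEstimates.

(** * The Green kernel of a hyperbolic splitting *)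

Section LinearSubspaces.
Context {R : realType} {T : normedModType R}.
Variables (E : set T) (subE : linear_subspace E).

Lemma linear_subspaceB u v : E u -> E v -> E (u - v).
Proof.
by move=> Eu Ev; have := subE.2 (-1) v u Ev Eu; rewrite scaleN1r addrC.
Qed.

End LinearSubspaces.

Section IteratedDerivative.
Context {R : realType} {T : normedModType R}.
Variables (f : T -> T) (L : set T).
Hypotheses (fL : invariant_set f L) (df : forall y, L y -> differentiable f y).

Lemma differentiable_iter n y : L y -> differentiable (iter n f) y.
Proof.
move=> Ly; elim: n => [|n IH].
  by have : differentiable (id : T -> T) y by [].
apply: (@differentiable_comp _ _ _ _ (iter n f) f) => //.
exact/df/(invariant_iter _ fL).
Qed.

Lemma diff_iter0 y v : 'd (iter 0 f) y v = v.
Proof.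
have : 'd (id : T -> T) y = id :> (T -> T) by exact: diff_val.
by move/(congr1 (fun h : T -> T => h v)).
Qed.

Lemma diff_iterS n y v : L y ->
  'd (iter n.+1 f) y v = 'd f (iter n f y) ('d (iter n f) y v).
Proof.
move=> Ly; have := diff_comp (differentiable_iter n Ly)
  (df (invariant_iter n fL Ly)).
by move/(congr1 (fun h : T -> T => h v)).
Qed.

Lemma diff_iterSr n y v : L y ->
  'd (iter n.+1 f) y v = 'd (iter n f) (f y) ('d f y v).
Proof.
move=> Ly; have Lfy : L (f y) := invariant_iter 1 fL Ly.
elim: n => [|n IH]; first by rewrite (diff_iterS 0 v Ly) !diff_iter0.
by rewrite (diff_iterS n.+1 v Ly) IH (diff_iterS n _ Lfy) -iterSr.
Qed.

Lemma diff_iter_bound M n y v : 0 <= M ->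
  (forall z w, L z -> `|'d f z w| <= M * `|w|) ->
  L y -> `|'d (iter n f) y v| <= M ^+ n * `|v|.
Proof.
move=> M0 fM Ly; elim: n => [|n IH]; first by rewrite diff_iter0 mul1r.
rewrite diff_iterS// exprS -mulrA (le_trans (fM _ _ _)) ?ler_wpM2l//.
exact: invariant_iter.
Qed.

End IteratedDerivative.

Section GreenKernel.
Context {R : realType} {T : normedModType R}.

(** With [x (-n)] standing for [iter n f (x 0)], [S j x] carries a vector at
    [x j] to the stable space at [x 0], and [U j x] carries a vector at
    [x (-j)] back to the unstable space at [x 0].  The push laws describe the
    action of the derivative on the result, and the pull laws its action on
    the argument. *)
Record green_kernel (f : T -> T) (L : set T)
    (S U : nat -> (nat -> T) -> T -> T) (q lam : R) : Prop := {
  green_const_gt0 : 0 < q;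
  green_rate : 0 < lam < 1;
  green_stableB : forall j x v w, inverse_limit f L x ->
    S j x (v - w) = S j x v - S j x w;
  green_unstableB : forall j x v w, inverse_limit f L x ->
    U j x (v - w) = U j x v - U j x w;
  green_stable_bound : forall j x v, inverse_limit f L x ->
    `|S j x v| <= q * lam ^+ j * `|v|;
  green_unstable_bound : forall j x v, inverse_limit f L x ->
    `|U j x v| <= q * lam ^+ j * `|v|;
  green_id : forall x v, inverse_limit f L x -> S 0%N x v + U 0%N x v = v;
  green_stable_push : forall j x v, inverse_limit f L x ->
    S j.+1 x v = 'd f (x 1%N) (S j (unshift x) v);
  green_stable_pull : forall j x v, inverse_limit f L x ->
    S j.+1 x v = S j x ('d f (x j.+1) v);
  green_unstable_push : forall j x v, inverse_limit f L x ->
    'd f (x 0%N) (U j.+1 x v) = U j (hat_shift f x) v;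
  green_unstable_pull : forall j x v, inverse_limit f L x ->
    U j.+1 x ('d f (iter j f (x 0%N)) v) = U j x v
}.

Variables (f : T -> T) (L : set T) (Es : T -> set T) (Eu : (nat -> T) -> set T).
Hypotheses (fL : invariant_set f L) (df : forall y, L y -> differentiable f y).
Hypothesis (hyp : hyperbolic_splitting f L Es Eu).
Variables (M : R).
Hypotheses (M0 : 0 < M) (fM : forall y v, L y -> `|'d f y v| <= M * `|v|).

Let hatL := inverse_limit f L.

Let Es_sub x : hatL x -> linear_subspace (Es (x 0%N)).
Proof. by move=> Lx; apply: stable_subspace hyp _ _; case: (Lx 0%N). Qed.

Let Eu_sub x : hatL x -> linear_subspace (Eu x).
Proof. by move=> Lx; apply: unstable_subspace hyp _ _. Qed.

Lemma splitting_unique x v s t : hatL x -> Es (x 0%N) s -> Eu x (v - s) ->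
  Es (x 0%N) t -> Eu x (v - t) -> s = t.
Proof.
move=> Lx ss us st ut; apply/eqP; rewrite -subr_eq0; apply/eqP.
suff : (Es (x 0%N) `&` Eu x) (s - t) by rewrite (splitting_direct hyp Lx).
split; first exact: (linear_subspaceB (Es_sub Lx)).
have -> : s - t = (v - t) - (v - s) by rewrite opprB [RHS]addrC addrA subrK.
exact: (linear_subspaceB (Eu_sub Lx)).
Qed.

(** A vector whose two components nearly cancel would, after a fixed number of
    steps, be mapped to a vector dominated by the huge unstable component,
    against the bound on the derivative.  So the angle between the stable and
    unstable spaces is bounded below. *)
Lemma unstable_component_bound : exists2 p : R, 0 < p &
  forall x s u, hatL x -> Es (x 0%N) s -> Eu x u -> `|u| <= p * `|s + u|.
Proof.
have [C [lam [C0 lam0 lam1 rs ru]]] := hyperbolic_rates hyp.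
(* Such an [n] makes stable vectors shrink below one half of their length and
   unstable ones grow beyond twice it. *)
have [n hn] : exists n, lam ^+ n < (2 * C)^-1.
  have C20 : 0 < (2 * C)^-1 by rewrite invr_gt0 mulr_gt0.
  have : (fun n => lam ^+ n) @ \oo --> (0 : R).
    by apply: cvg_expr; rewrite gtr0_norm.
  move=> /cvgr0Pnorm_lt /(_ _ C20)[n _ /(_ n (leqnn n))] /=.
  by rewrite gtr0_norm ?exprn_gt0// => h; exists n.
exists (M ^+ n + 1) => [|x s u Lx Ess Euu]; first by rewrite ltr_wpDl//
  exprn_ge0// ltW.
have [Lx0 _] := Lx 0%N.
have t0 : 0 < lam ^+ n by rewrite exprn_gt0.
set t := lam ^+ n in hn t0.
have Ct : C * t < 2^-1.
  by rewrite mulrC -ltr_pdivlMr//; move: hn; rewrite invfM.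
have Ct2 : 2 < C^-1 * t^-1.
  rewrite -invfM -[ltLHS]invrK ltf_pV2 ?posrE ?invr_gt0// mulr_gt0//.
have A := ru x u n Lx Euu; have B := rs _ s n Lx0 Ess.
have D := @diff_iter_bound R T f L fL df M n (x 0%N) (s + u) (ltW M0) fM Lx0.
rewrite linearD /= -/t in A B D.
have E := lerB_normD ('d (iter n f) (x 0%N) u) ('d (iter n f) (x 0%N) s).
have F := lerB_normD s u.

have {}A : 2 * `|u| <= `|'d (iter n f) (x 0%N) u|.
  by rewrite (le_trans _ A)// ler_wpM2r// ltW.
have {}B : `|'d (iter n f) (x 0%N) s| <= 2^-1 * `|s|.
  by rewrite (le_trans B)// ler_wpM2r// ltW.
have G : 0 <= M ^+ n * `|s + u| by rewrite mulr_ge0// exprn_ge0// ltW.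
have W := normr_ge0 (s + u).
by rewrite addrC in D; rewrite mulrDl mul1r; lra.
Qed.

(** [S j x] projects to the stable space at [x j] and applies the derivative of
    the [j]-th iterate; [U j x] projects to the unstable space at [x (-j)]
    and inverts, along the given prehistory, the derivative between unstable
    spaces, where it is bijective.  Projections commute with the derivative
    because both spaces are invariant, which gives the pull laws. *)
Lemma hyperbolic_green_kernel : exists S U q lam, green_kernel f L S U q lam.
Proof.
have [p p0 pP] := unstable_component_bound.
have [C [lam [C0 lam0 lam1 rs ru]]] := hyperbolic_rates hyp.
have [v|P PP] := @choice T ((nat -> T) -> T) (fun v s => forall x, hatL x ->
    Es (x 0%N) (s x) /\ Eu x (v - s x)).
  by have [s _ sP] := splitting_continuous hyp v; exists s.
have Pu v x : hatL x -> `|v - P v x| <= p * `|v|.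
  by move=> Lx; have [? ?] := PP v x Lx; have := pP x (P v x) (v - P v x) Lx;
    rewrite subrKC; exact.
have Ps v x : hatL x -> `|P v x| <= (1 + p) * `|v|.
  move=> Lx; rewrite -[P v x](subKr v) (le_trans (ler_normB _ _))//.
  by rewrite mulrDl mul1r lerD2l Pu.
have PB v w x : hatL x -> P (v - w) x = P v x - P w x.
  move=> Lx; have [sv uv] := PP v x Lx; have [sw uw] := PP w x Lx.
  have [svw uvw] := PP (v - w) x Lx.
  apply: (splitting_unique Lx svw uvw).
    exact: (linear_subspaceB (Es_sub Lx)).
  by rewrite opprD addrACA -opprD; exact: (linear_subspaceB (Eu_sub Lx)).
have PA v x : hatL x -> P ('d f (x 0%N) v) (hat_shift f x) = 'd f (x 0%N) (P v
  x).
  move=> Lx; have [sv uv] := PP v x Lx; have [Lx0 _] := Lx 0%N.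
  have LSx := inverse_limit_shift fL Lx.
  have [sA uA] := PP ('d f (x 0%N) v) _ LSx.
  apply: (splitting_unique LSx sA uA).
    by apply: (stable_invariant hyp) => //; exists (P v x).
  rewrite -(unstable_invariant hyp)//; exists (v - P v x) => //.
  exact: linearB.
(* [B (x, w)] is the preimage of [w] in the unstable space of [x], and [back]
   iterates it. *)
have [[x w]|B BP] := @choice ((nat -> T) * T) T (fun xw z => hatL xw.1 ->
    Eu (hat_shift f xw.1) xw.2 -> Eu xw.1 z /\ 'd f (xw.1 0%N) z = xw.2).
  have [[Lx]|nLx] := pselect (hatL x /\ Eu (hat_shift f x) w).
    by rewrite -(unstable_invariant hyp)// => -[z Ez Az]; exists z.
  by exists 0 => Lx Ew; case: nLx.
have inj x v w : hatL x -> Eu x v -> Eu x w ->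
    'd f (x 0%N) v = 'd f (x 0%N) w -> v = w.
  move=> Lx Ev Ew Avw; apply/eqP; rewrite -subr_eq0 -normr_eq0.
  have [Lx0 _] := Lx 0%N.
  have := ru x (v - w) 1%N Lx (linear_subspaceB (Eu_sub Lx) Ev Ew).
  rewrite (diff_iterS fL df 0 (v - w) Lx0) (diff_iter0 f (x 0%N)) linearB Avw
    subrr normr0.
  by rewrite pmulr_rle0 ?normr_le0 ?normr_eq0// mulr_gt0 ?invr_gt0// exprn_gt0.
pose back := fix back j x w :=
  if j is i.+1 then B (x, back i (hat_shift f x) w) else w : T.
have backE j x w : hatL x -> Eu (iter j (hat_shift f) x) w -> Eu x (back j x w)
  /\
    'd (iter j f) (x 0%N) (back j x w) = w.
  elim: j x => [|j IH] x Lx Ew; first by split=> //=; exact: diff_iter0.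
  have LSx := inverse_limit_shift fL Lx.
  rewrite iterSr in Ew; have [Eb Ab] := IH _ LSx Ew.
  have [EB AB] := BP (x, back j (hat_shift f x) w) Lx Eb.
  split=> //; have [Lx0 _] := Lx 0%N.
  by rewrite (diff_iterSr fL df j _ Lx0) AB.
have backB j x v w : hatL x -> Eu (iter j (hat_shift f) x) v ->
    Eu (iter j (hat_shift f) x) w -> back j x (v - w) = back j x v - back j x w.
  elim: j x => [//|j IH] x Lx; rewrite iterSr => Ev Ew /=.
  have LSx := inverse_limit_shift fL Lx.
  have [Eb _] := backE j _ v LSx Ev; have [Eb' _] := backE j _ w LSx Ew.
  have Ebb := linear_subspaceB (Eu_sub LSx) Eb Eb'.
  rewrite IH//; have [EB AB] := BP (x, _) Lx Eb; have [EB' AB'] := BP (x,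
    _) Lx Eb'.
  have [EBB ABB] := BP (x, _) Lx Ebb.
  apply: (inj x) => //; first exact: (linear_subspaceB (Eu_sub Lx)).
  by rewrite ABB linearB AB AB'.
have back_pull j x w : hatL x -> Eu (iter j (hat_shift f) x) w ->
    back j.+1 x ('d f (iter j f (x 0%N)) w) = back j x w.
  elim: j x => [|j IH] x Lx Ew.
    have EA : Eu (hat_shift f x) ('d f (x 0%N) w).
      by rewrite -(unstable_invariant hyp)//; exists w.
    by have [EB AB] := BP (x, _) Lx EA; exact: (inj x).
  rewrite iterSr in Ew.
  rewrite -[LHS]/(B (x, back j.+1 (hat_shift f x) _)).
  by rewrite iterSr (IH (hat_shift f x))//; exact: inverse_limit_shift.
have LSn n x : hatL x -> hatL (iter n (hat_shift f) x).
  exact: inverse_limit_iter_shift.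
have Ltn n x : hatL x -> hatL (iter n unshift x).
  exact: inverse_limit_iter_unshift.
have tn0 n x : iter n unshift x 0%N = x n by rewrite iter_unshift addn0.
exists (fun j x v => 'd (iter j f) (x j) (P v (iter j unshift x))),
  (fun j x v => back j x (v - P v (iter j (hat_shift f) x))),
  (C * (1 + p)), lam.
have PEu j x v : hatL x -> Eu (iter j (hat_shift f) x) (v - P v (iter j
  (hat_shift f) x)).
  by move=> Lx; have [] := PP v _ (LSn j x Lx).
split.
- by rewrite mulr_gt0// addr_gt0.
- by rewrite lam0.
- by move=> j x v w Lx; rewrite PB ?linearB//; exact: Ltn.
- move=> j x v w Lx; rewrite PB; last exact: LSn.
  have -> u u' : v - w - (u - u') = v - u - (w - u') by rewrite opprD addrACA
    -opprD.
  by apply: backB => //; exact: PEu.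
- move=> j x v Lx; have [Lxj _] := Lx j.
  have [Pj _] := PP v _ (Ltn j x Lx); rewrite tn0 in Pj.
  rewrite (le_trans (rs _ _ j Lxj Pj))//.
  have -> : C * (1 + p) * lam ^+ j * `|v| = C * lam ^+ j * ((1 + p) * `|v|) by
    ring.
  rewrite ler_wpM2l ?Ps//; first by rewrite mulr_ge0 ?exprn_ge0 ?ltW.
  exact: Ltn.
- move=> j x v Lx; have [Eb Ab] := backE j x _ Lx (PEu j x v Lx).
  have := ru x _ j Lx Eb; rewrite Ab -invfM ler_pdivrMl ?mulr_gt0 ?exprn_gt0//.
  move=> /le_trans; apply.
  have -> : C * (1 + p) * lam ^+ j * `|v| = C * lam ^+ j * ((1 + p) * `|v|) by
    ring.
  rewrite ler_wpM2l//; first by rewrite mulr_ge0 ?exprn_ge0 ?ltW.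
  rewrite (le_trans (Pu _ _ (LSn j x Lx)))// ler_wpM2r// lerDr//.
- by move=> x v Lx; rewrite /= diff_iter0 subrKC.
- move=> j x v Lx; have [Lxj _] := Lx j.+1.
  have := iter_prehistory (fun i => (Lx i).2) j 1; rewrite addn1 => xj.
  by rewrite (diff_iterS fL df j _ Lxj) xj iterSr.
- move=> j x v Lx; have [Lxj fx] := Lx j.+1.
  rewrite (diff_iterSr fL df j _ Lxj); have [_ ->] := Lx j.
  have := PA v _ (Ltn j.+1 x Lx); rewrite tn0 => <-.
  by rewrite /= (unshiftK (Ltn j x Lx)).
- move=> j x v Lx; have E := PEu j.+1 x v Lx; rewrite iterSr in E.
  have [Eb _] := backE j _ _ (inverse_limit_shift fL Lx) E.
  by have [_ AB] := BP (x, _) Lx Eb; rewrite iterSr; exact: AB.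
- move=> j x v Lx; rewrite -iter_hat_shift0 iterS (PA _ _ (LSn j x Lx)).
  by rewrite -linearB iter_hat_shift0 back_pull//; exact: PEu.
Qed.

End GreenKernel.

(** * Inverting the linearized equation *)

Lemma sum_geometric_le (R : realFieldType) (z : R) n : 0 < z < 1 ->
  \sum_(j < n) z ^+ j <= (1 - z)^-1.
Proof.
move=> /andP[z0 z1]; have z10 : 0 < 1 - z by rewrite subr_gt0.
have := subrX1 z n; rewrite -opprB -[z - 1]opprB mulNr => /oppr_inj e.
by rewrite -[leRHS]mul1r ler_pdivlMr// mulrC -e gerBl exprn_ge0// ltW.
Qed.

Lemma telescope_ord (V : zmodType) (F : nat -> V) n :
  \sum_(j < n) F j - \sum_(j < n) F j.+1 = F 0%N - F n.
Proof.
elim: n => [|n IH]; first by rewrite !big_ord0 !subrr.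
by rewrite !big_ord_recr /= opprD addrACA IH addrA subrK.
Qed.

Section GreenOperator.
Context {R : realType} {T : normedModType R}.
Variables (f : T -> T) (L : set T) (S U : nat -> (nat -> T) -> T -> T).
Variables (q lam : R).
Hypotheses (fL : invariant_set f L) (G : green_kernel f L S U q lam).

Let hatL := inverse_limit f L.
Let sigma := hat_shift f.

(** The sum of the geometric bounds on both halves of the kernel. *)
Definition green_norm := 2 * q / (1 - lam).

Lemma green_norm_gt0 : 0 < green_norm.
Proof.
have [q0 /andP[_ lam1]] := (green_const_gt0 G, green_rate G).
by rewrite divr_gt0 ?mulr_gt0 ?subr_gt0.
Qed.

Lemma green_sum_le n e : 0 <= e ->
  \sum_(j < n) q * lam ^+ j * e <= q / (1 - lam) * e.
Proof.
move=> e0; rewrite -mulr_suml -mulr_sumr ler_wpM2r// ler_wpM2l//.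
  exact/ltW/(green_const_gt0 G).
exact: sum_geometric_le (green_rate G).
Qed.

Lemma green_normE e : green_norm * e = q / (1 - lam) * e + q / (1 - lam) * e.
Proof. by rewrite /green_norm; ring. Qed.

Let rate_le j e : 0 <= e -> q * lam ^+ j.+1 * e <= q * lam ^+ j * e.
Proof.
move=> e0; have /andP[l0 l1] := green_rate G; have q0 := green_const_gt0 G.
by rewrite ler_wpM2r// ler_wpM2l ?(ltW q0)// exprS ler_piMl ?ltW// exprn_gt0.
Qed.

Definition green_op n (h : (nat -> T) -> T) x :=
  \sum_(j < n) S j x (h (iter j unshift x)) -
  \sum_(j < n) U j.+1 x (h (iter j.+1 sigma x)).

Lemma green_op_bound n h e x : 0 <= e -> (forall y, hatL y -> `|h y| <= e) ->
  hatL x -> `|green_op n h x| <= green_norm * e.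
Proof.
move=> e0 he Lx; have q0 := green_const_gt0 G;
  have /andP[l0 l1] := green_rate G.
have ql0 j : 0 <= q * lam ^+ j by rewrite mulr_ge0 ?exprn_ge0 ?ltW.
rewrite green_normE (le_trans (ler_normB _ _))// lerD//.
  apply: le_trans (green_sum_le n e0); apply: (le_trans (ler_norm_sum _ _ _)).
  apply: ler_sum => j _; apply: (le_trans (green_stable_bound G _ _ Lx)).
  by rewrite ler_wpM2l// he//; exact: inverse_limit_iter_unshift.
apply: le_trans (green_sum_le n e0); apply: (le_trans (ler_norm_sum _ _ _)).
apply: ler_sum => j _; apply: le_trans (rate_le j e0).
apply: (le_trans (green_unstable_bound G _ _ Lx)).
by rewrite ler_wpM2l// he//; exact: inverse_limit_iter_shift.
Qed.

(** By the push laws the derivative shifts the index in both sums, so that only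
    the first and the last terms survive; the first ones add up to [h y]. *)
Lemma green_op_inverse n h x : hatL x -> let y := sigma x in
  green_op n h y - 'd f (x 0%N) (green_op n h x) =
  h y - S n y (h (iter n unshift y)) - U n y (h (iter n sigma y)).
Proof.
move=> Lx y; have Ly : hatL y by exact: inverse_limit_shift.
rewrite /green_op linearB !(linear_sum ('d f (x 0%N))).
have -> : \sum_(j < n) 'd f (x 0%N) (S j x (h (iter j unshift x))) =
          \sum_(j < n) S j.+1 y (h (iter j.+1 unshift y)).
  by apply: eq_bigr => j _; rewrite (green_stable_push G _ _ Ly) iterSr
    hat_shiftK.
have -> : \sum_(j < n) 'd f (x 0%N) (U j.+1 x (h (iter j.+1 sigma x))) =
          \sum_(j < n) U j y (h (iter j sigma y)).
  by apply: eq_bigr => j _; rewrite (green_unstable_push G _ _ Lx) iterSr.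
rewrite opprD opprK addrACA [- _ + _]addrC.
rewrite (telescope_ord (fun j => S j y (h (iter j unshift y)))).
rewrite (telescope_ord (fun j => U j y (h (iter j sigma y)))) /=.
by rewrite addrACA (green_id G _ Ly) -opprD opprD addrA.
Qed.

(** The sequence [a] runs into the past of [x] and [b] into its future.  By the
    pull laws [S j x (a j)] changes with [j] only by the image of the error of
    [a], and likewise for [U] and [b].  The stable part of the value at time 0
    is thus controlled by the past end and the unstable part by the future
    end. *)
Lemma green_a_priori k x (a b : nat -> T) e W : hatL x -> 0 <= e -> 
  a 0%N = b 0%N ->
  (forall j, (j < k)%N -> `|a j - 'd f (x j.+1) (a j.+1)| <= e) ->
  (forall j, (j < k)%N -> `|b j.+1 - 'd f (iter j f (x 0%N)) (b j)| <= e) ->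
  `|a k| <= W -> `|b k| <= W ->
  `|a 0%N| <= 2 * q * lam ^+ k * W + green_norm * e.
Proof.
move=> Lx e0 ab ha hb hak hbk; have q0 := green_const_gt0 G;
  have /andP[l0 l1] := green_rate G.
have ql0 j : 0 <= q * lam ^+ j by rewrite mulr_ge0 ?exprn_ge0 ?ltW.
have -> : 2 * q * lam ^+ k * W = q * lam ^+ k * W + q * lam ^+ k * W by ring.
rewrite green_normE addrACA -(green_id G (a 0%N) Lx).
rewrite (le_trans (ler_normD _ _))// lerD//.
  have -> : S 0 x (a 0%N) = S k x (a k) +
      \sum_(j < k) S j x (a j - 'd f (x j.+1) (a j.+1)).
    elim: k {ha hak hbk hb} => [|k IH]; first by rewrite big_ord0 addr0.
    rewrite big_ord_recr/= (green_stableB G _ _ _ Lx) -(green_stable_pull G _ _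
      Lx).
    by rewrite [RHS]addrC -addrA subrK addrC.
  rewrite (le_trans (ler_normD _ _))// lerD//.
    by rewrite (le_trans (green_stable_bound G _ _ Lx))// ler_wpM2l.
  apply: le_trans (green_sum_le k e0); apply: (le_trans (ler_norm_sum _ _ _)).
  apply: ler_sum => j _; apply: (le_trans (green_stable_bound G _ _ Lx)).
  by rewrite ler_wpM2l// ha.
rewrite ab; have -> : U 0 x (b 0%N) = U k x (b k) -
    \sum_(j < k) U j.+1 x (b j.+1 - 'd f (iter j f (x 0%N)) (b j)).
  elim: k {ha hak hbk hb} => [|k IH]; first by rewrite big_ord0 subr0.
  rewrite big_ord_recr/= (green_unstableB G _ _ _ Lx) (green_unstable_pull G _
    _ Lx).
  by rewrite opprD opprB [RHS]addrC -addrA subrK addrC.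
rewrite (le_trans (ler_normB _ _))// lerD//.
  by rewrite (le_trans (green_unstable_bound G _ _ Lx))// ler_wpM2l.
apply: le_trans (green_sum_le k e0); apply: (le_trans (ler_norm_sum _ _ _)).
apply: ler_sum => j _; apply: le_trans (rate_le j e0).
apply: (le_trans (green_unstable_bound G _ _ Lx)).
by rewrite ler_wpM2l// hb.
Qed.

End GreenOperator.

(** * Convergence of sequences *)

Section Limits.
Context {R : realType} {T : normedModType R}.

Lemma near_geometric_le (c z e : R) : `|z| < 1 -> 0 < e ->
  \forall n \near \oo, c * z ^+ n < e.
Proof.
move=> z1 e0; have := cvg_geometric c z1.
move=> /cvgr0Pnorm_lt/(_ _ e0); apply: filterS => n; rewrite /geometric /=.
exact/le_lt_trans/ler_norm.
Qed.

Lemma norm_limit_le (w : nat -> T) (l : T) (c : R) :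
  w @ \oo --> l -> (\forall n \near \oo, `|w n| <= c) -> `|l| <= c.
Proof.
move=> wl wc; apply/ler_addgt0Pr => e e0.
move/cvgrPdist_lt/(_ _ e0): wl => wl.
have [n [wn ln]] := filter_ex (filterI wc wl).
by rewrite -[l](subrK (w n)) addrC (le_trans (ler_normD _ _))// lerD// ltW.
Qed.

Lemma cauchy_sequence_cvg (fdT : finite_dimensional T) (w : nat -> T) :
  (forall e, 0 < e -> exists N, forall n, (N <= n)%N -> `|w N - w n| < e) ->
  cvg (w @ \oo).
Proof.
move=> wP; apply: (finite_dimensional_complete fdT).
apply: cauchy_exP => e e0; have [N NP] := wP e e0.
exists (w N); exists N => // n /= Nn.
by rewrite -ball_normE; exact: NP.
Qed.

Lemma geometric_increments_cvg (fdT : finite_dimensional T) (w : nat -> T) (c :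
  R) :
  (forall j, `|w j.+1 - w j| <= c * 2^-1 ^+ j) -> cvg (w @ \oo).
Proof.
move=> wc; apply: (cauchy_sequence_cvg fdT) => e e0.
have c0 : 0 <= c by have := wc 0%N; rewrite mulr1; exact: le_trans.
have wjk j k : `|w j - w (j + k)%N| <= 2 * c * 2^-1 ^+ j * (1 - 2^-1 ^+ k).
  elim: k => [|k IH]; first by rewrite addn0 !subrr normr0 mulr0.
  rewrite addnS (le_trans (ler_distD (w (j + k)%N) _ _))//.
  have h : `|w (j + k)%N - w (j + k).+1| <= c * (2^-1 ^+ j * 2^-1 ^+ k).
    by rewrite distrC -exprD.
  by apply: (le_trans (lerD IH h)); rewrite exprS; lra.
have h1 : `|2^-1 : R| < 1 by rewrite ger0_norm ?invr_ge0// invf_lt1// ltr1n.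
have [N _ NP] := near_geometric_le (2 * c) h1 e0.
exists N => n /subnKC <-; apply: (le_lt_trans (wjk _ _)).
apply: le_lt_trans (NP N (leqnn N)).
by rewrite ler_piMr ?gerBl ?mulr_ge0 ?exprn_ge0 ?invr_ge0.
Qed.

End Limits.

(** * Orbits of the perturbed map near the hyperbolic set *)

Section ShadowingMap.
Context {R : realType} {T : normedModType R}.
Hypothesis fdT : finite_dimensional T.
Variables (f : T -> T) (L : set T) (S U : nat -> (nat -> T) -> T -> T).
Variables (q lam : R).
Hypotheses (fL : invariant_set f L) (G : green_kernel f L S U q lam).
Let M := green_norm q lam.
Let hatL := inverse_limit f L.
Let sigma := hat_shift f.

Variables (g : T -> T) (r d e : R).
Hypotheses (e0 : 0 <= e) (d0 : 0 <= d) (dM : d * M <= 4^-1) (eM : 2 * M * e <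
  r).
Hypothesis g_linear : forall x y z, L x -> `|y - x| < r -> `|z - x| < r ->
  `|g y - g z - 'd f x (y - z)| <= d * `|y - z|.
Hypothesis g_cont : forall x y, L x -> `|y - x| < r -> {for y, continuous g}.
Hypothesis g_close : forall x, L x -> `|f x - g x| <= e.

(** The equation for [u] read at [x], one step after [unshift x]. *)
Definition defect (u : (nat -> T) -> T) x :=
  g (x 1%N + u (unshift x)) - x 0%N - u x.

(** Newton's method with an approximate inverse: the truncated Green operator
    inverts the linearized equation up to a quarter of the defect, the
    nonlinearity contributes another quarter, so that each step halves the
    defect. *)
Lemma shadowing_map : exists phi : (nat -> T) -> T, forall x, hatL x ->
  `|phi x - x 0%N| <= 2 * M * e /\ g (phi x) = phi (sigma x).
Proof.
have q0 := green_const_gt0 G; have /andP[l0 l1] := green_rate G.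
have M0 : 0 < M := green_norm_gt0 G.
have Me0 : 0 <= 2 * M * e by rewrite mulr_ge0// mulr_ge0// ltW.
have [N Nq] : exists N, 2 * q * lam ^+ N < 4^-1.
  have l1' : `|lam| < 1 by rewrite gtr0_norm.
  have h4 : 0 < 4^-1 :> R by rewrite invr_gt0.
  have [n _ nP] := near_geometric_le (2 * q) l1' h4.
  by exists n; apply: nP => /=.
pose K h := green_op f S U N h.
pose newton u x := u x + K (defect u) x : T.
pose u j := iter j newton (fun=> 0).
have uS j x : u j.+1 x - u j x = K (defect (u j)) x by rewrite /= addrC addKr.
have h0 j : 0 <= 2^-1 ^+ j :> R by rewrite exprn_ge0 ?invr_ge0.
(* The bound on [u j] keeps it in the region of linear approximation. *)
have uP j : (forall x, hatL x -> `|u j x| <= 2 * M * e * (1 - 2^-1 ^+ j)) /\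
            (forall x, hatL x -> `|defect (u j) x| <= e * 2^-1 ^+ j).
  elim: j => [|j [IHu IHd]].
    split=> x Lx; first by rewrite normr0 subrr mulr0.
    have [Lx1 fx1] := Lx 1%N; have [_ fx] := Lx 0%N.
    by rewrite /defect addr0 subr0 -fx distrC mulr1 g_close.
  have ej0 : 0 <= e * 2^-1 ^+ j by rewrite mulr_ge0.
  have KP x : hatL x -> `|K (defect (u j)) x| <= M * (e * 2^-1 ^+ j).
    by move=> Lx; exact: (green_op_bound fL G N ej0 IHd Lx).
  have IHu' x : hatL x -> `|u j.+1 x| <= 2 * M * e * (1 - 2^-1 ^+ j.+1).
    move=> Lx; rewrite (le_trans (ler_normD _ _))// (le_trans (lerD (IHu x Lx)
      (KP x Lx)))//.
    by rewrite exprS; lra.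
  have small i x : hatL x -> `|u i x| <= 2 * M * e * (1 - 2^-1 ^+ i) ->
      `|x 0%N + u i x - x 0%N| < r.
    move=> Lx ui; rewrite addrAC subrr add0r (le_lt_trans ui)// (le_lt_trans _
      eM)//.
    by rewrite ler_piMr ?gerBl.
  split=> // y Ly; rewrite -(unshiftK Ly); set x := unshift y.
  have Lx : hatL x := inverse_limit_unshift Ly; have [Lx0 _] := Lx 0%N.
  have Lsx : hatL (sigma x) := inverse_limit_shift fL Lx.
  have inv := green_op_inverse fL G N (defect (u j)) Lx.
  have dE v : defect v (sigma x) = g (x 0%N + v x) - f (x 0%N) - v (sigma x) by
    [].
  (* Identities of the additive group of [T]. *)
  have alg2 (h s t : T) : s + t = h - (h - s - t) by rewrite -addrA -opprD
    subKr.
  have alg (a b c v k l : T) :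
      a - c - (v + k) = (a - b - l) + (b - c - v - (k - l)).
    by rewrite opprB [b - c - v + _]addrCA [RHS]addrA subrK -!addrA addKr opprD.
  have nl := g_linear Lx0 (small j.+1 x Lx (IHu' x Lx)) (small j x Lx (IHu x
    Lx)).
  have uu : x 0%N + u j.+1 x - (x 0%N + u j x) = K (defect (u j)) x.
    by rewrite opprD addrACA subrr add0r uS.
  rewrite uu in nl.
  have us : u j.+1 (sigma x) = u j (sigma x) + K (defect (u j)) (sigma x).
    by rewrite -uS subrKC.
  have -> : defect (u j.+1) (sigma x) =
      (g (x 0%N + u j.+1 x) - g (x 0%N + u j x) - 'd f (x 0%N) (K (defect (u
        j)) x)) +
      (S N (sigma x) (defect (u j) (iter N unshift (sigma x))) +
       U N (sigma x) (defect (u j) (iter N sigma (sigma x)))).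
    have -> : S N (sigma x) (defect (u j) (iter N unshift (sigma x))) +
       U N (sigma x) (defect (u j) (iter N sigma (sigma x))) =
       defect (u j) (sigma x) - (K (defect (u j)) (sigma x) -
         'd f (x 0%N) (K (defect (u j)) x)).
      by rewrite inv; exact: alg2.
    by rewrite !dE us; exact: alg.
  have Sb := green_stable_bound G N (defect (u j) (iter N unshift (sigma x)))
    Lsx.
  have Ub := green_unstable_bound G N (defect (u j) (iter N sigma (sigma x)))
    Lsx.
  have D1 := IHd _ (inverse_limit_iter_unshift N Lsx).
  have D2 := IHd _ (inverse_limit_iter_shift N fL Lsx).
  have K1 := KP x Lx.
  have ql0 : 0 <= q * lam ^+ N by rewrite mulr_ge0 ?exprn_ge0 ?ltW.
  have E1 := le_trans Sb (ler_wpM2l ql0 D1).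
  have E2 := le_trans Ub (ler_wpM2l ql0 D2).
  have E3 := le_trans nl (ler_wpM2l d0 K1).
  rewrite (le_trans (ler_normD _ _))// (le_trans (lerD E3 (ler_normD _ _)))//.
  have E4 := ler_wpM2r ej0 dM.
  have E5 := ler_wpM2r ej0 (ltW Nq).
  rewrite exprS; set z := 2^-1 ^+ j in E1 E2 E3 E4 E5 *.
  apply: (le_trans (lerD (lexx _) (lerD E1 E2))).
  lra.
pose w x := fun j => u j x.
have wcv x : hatL x -> cvg (w x @ \oo).
  move=> Lx; apply: (@geometric_increments_cvg _ _ fdT _ (M * e)) => j.
  rewrite /w uS -mulrA; apply: (green_op_bound fL G) => //;
    first exact: mulr_ge0.
  exact: (uP j).2.
have wl x : hatL x -> w x @ \oo --> lim (w x @ \oo) by exact: wcv.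
have limb x : hatL x -> `|lim (w x @ \oo)| <= 2 * M * e.
  move=> Lx; apply: (norm_limit_le (wl x Lx)); near=> j.
  rewrite (le_trans ((uP j).1 x Lx))// ler_piMr// gerBl//.
exists (fun x => x 0%N + lim (w x @ \oo)) => x Lx.
rewrite addrAC subrr add0r; split; first exact: limb.
have [Lx0 _] := Lx 0%N; have Lsx : hatL (sigma x) := inverse_limit_shift fL Lx.
have gw : g (x 0%N + w x j) @[j --> \oo] --> g (x 0%N + lim (w x @ \oo)).
  apply: cvg_comp; last first.
    apply: (g_cont Lx0); rewrite addrAC subrr add0r.
    exact: le_lt_trans (limb x Lx) eM.
  by apply: cvgD; [exact: cvg_cst|exact: wl].
have dl : (fun j => defect (u j) (sigma x)) @ \oo -->
    g (x 0%N + lim (w x @ \oo)) - (sigma x) 0%N - lim (w (sigma x) @ \oo).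
  by apply: cvgB; [apply: cvgB; [exact: gw|exact: cvg_cst]|exact: wl].
apply/eqP; rewrite -subr_eq0 opprD addrA -normr_le0.
apply/ler_addgt0Pr => c c0; rewrite add0r; apply: (norm_limit_le dl).
have h1 : `|2^-1 : R| < 1 by rewrite ger0_norm ?invr_ge0// invf_lt1// ltr1n.
apply: filterS (near_geometric_le e h1 c0) => j ej.
exact: le_trans ((uP j).2 _ Lsx) (ltW ej).
Unshelve. all: by end_near. Qed.

End ShadowingMap.

(** * Orbits that follow the same hyperbolic orbit *)

Section Tracking.
Context {R : realType} {T : normedModType R}.

Definition tracks (f g : T -> T) (r : R) (m : nat) (x y : nat -> T) : Prop :=
  forall j, (j <= m)%N ->
    `|y j - x j| < r /\ `|iter j g (y 0%N) - iter j f (x 0%N)| < r.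

Definition prehistory (g : T -> T) (y : nat -> T) : Prop :=
  forall i, g (y i.+1) = y i.

Lemma prehistory_unshift g y : prehistory g y -> prehistory g (unshift y).
Proof. by move=> gy i; exact: gy. Qed.

Lemma prehistory_iter_unshift g n y :
  prehistory g y -> prehistory g (iter n unshift y).
Proof. by move=> gy; elim: n => //= n /prehistory_unshift. Qed.

Lemma prehistory_iter_shift g n y :
  prehistory g y -> prehistory g (iter n (hat_shift g) y).
Proof. by move=> gy; elim: n => //= n IH; case=> [|i] //=; exact: IH. Qed.

Variables (f g : T -> T) (r : R).

Lemma tracks_le m n x y : (m <= n)%N -> tracks f g r n x y -> tracks f g r m x
  y.
Proof. by move=> mn xy j jm; apply: xy; exact: leq_trans mn. Qed.

(** Shifting an orbit by [n] costs [n] at one end of the window. *)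
Lemma tracks_iter_unshift n m x y : prehistory f x -> prehistory g y ->
  tracks f g r (n + m) x y ->
  tracks f g r m (iter n unshift x) (iter n unshift y).
Proof.
move=> fx gy; elim: n m => [//|n IH] m; rewrite addSnnS => /IH{IH} xy [|j] jm.
  by rewrite /= /unshift; have [] := xy 1%N isT.
split; first by have [] := xy j.+2 jm.
rewrite (iterSr j g) (iterSr j f) /= /unshift.
rewrite (prehistory_iter_unshift n gy) (prehistory_iter_unshift n fx).
by have [] := xy j (leqW (ltnW jm)).
Qed.

Lemma tracks_iter_shift n m x y : tracks f g r (n + m) x y ->
  tracks f g r m (iter n (hat_shift f) x) (iter n (hat_shift g) y).
Proof.
elim: n m => [//|n IH] m; rewrite addSnnS => /IH{IH} xy [|j] jm.
  by have [_] := xy 1%N isT.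
split; first by have [] := xy j (leqW (ltnW jm)).
by have [_] := xy j.+2 jm; rewrite (iterSr j.+1 g) (iterSr j.+1 f).
Qed.

Variables (L : set T) (S U : nat -> (nat -> T) -> T -> T) (q lam d : R) (k :
  nat).
Hypotheses (fL : invariant_set f L) (G : green_kernel f L S U q lam).
Hypotheses (d0 : 0 <= d) (dM : d * green_norm q lam <= 4^-1).
Hypothesis kP : 2 * q * lam ^+ k <= 4^-1.
Hypothesis g_linear : forall x y z, L x -> `|y - x| < r -> `|z - x| < r ->
  `|g y - g z - 'd f x (y - z)| <= d * `|y - z|.

(** The difference of two orbits that stay close to the same hyperbolic orbit is
    almost an orbit of the derivative, and such sequences cannot be large in the
    middle of a window of length [k] unless they are twice as large at some
    point of it.  Iterating gives exponential decay in the length of the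
    window. *)
Lemma tracking_contraction J x y z : inverse_limit f L x ->
  prehistory g y -> prehistory g z ->
  tracks f g r (J * k) x y -> tracks f g r (J * k) x z ->
  `|y 0%N - z 0%N| <= 2 * r * 2^-1 ^+ J.
Proof.
elim: J x y z => [|J IH] x y z Lx gy gz xy xz.
  have [yx _] := xy 0%N isT; have [zx _] := xz 0%N isT.
  rewrite mulr1 (le_trans (ler_distD (x 0%N) _ _))// [`|x 0%N - _|]distrC.
  by rewrite mulr_natl mulr2n lerD// ltW.
set W := 2 * r * 2^-1 ^+ J.
have fx : prehistory f x by move=> i; have [] := Lx i.
have past j : (j <= k)%N -> `|y j - z j| <= W.
  move=> jk; have le : (j + J * k <= J.+1 * k)%N by rewrite mulSn leq_add2r.
  have := IH (iter j unshift x) (iter j unshift y) (iter j unshift z)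
    (inverse_limit_iter_unshift j Lx) (prehistory_iter_unshift j gy)
    (prehistory_iter_unshift j gz).
  rewrite !iter_unshift addn0; apply.
    by apply: tracks_iter_unshift => //; exact: tracks_le le xy.
  by apply: tracks_iter_unshift => //; exact: tracks_le le xz.
have future j : (j <= k)%N -> `|iter j g (y 0%N) - iter j g (z 0%N)| <= W.
  move=> jk; have le : (j + J * k <= J.+1 * k)%N by rewrite mulSn leq_add2r.
  have := IH (iter j (hat_shift f) x) (iter j (hat_shift g) y) (iter j
    (hat_shift g) z)
    (inverse_limit_iter_shift j fL Lx) (prehistory_iter_shift j gy)
    (prehistory_iter_shift j gz).
  rewrite !iter_hat_shift0; apply.
    by apply: tracks_iter_shift => //; exact: tracks_le le xy.
  by apply: tracks_iter_shift => //; exact: tracks_le le xz.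
have W0 : 0 <= W by apply: le_trans (past 0%N isT).
have kk j : (j <= k)%N -> (j <= J.+1 * k)%N.
  by move=> jk; rewrite (leq_trans jk)// mulSn leq_addr.
have e0 : 0 <= d * W by rewrite mulr_ge0.
have := @green_a_priori _ _ _ _ _ _ _ _ G k x (fun j => y j - z j)
  (fun j => iter j g (y 0%N) - iter j g (z 0%N)) (d * W) W Lx e0 erefl.
move=> /(_ _ _ (past k (leqnn k)) (future k (leqnn k))) h.
apply: le_trans (h _ _) _ => [j jk|j jk|].
- have [Lxj _] := Lx j.+1; rewrite -(gy j) -(gz j).
  have [yx _] := xy _ (kk _ jk); have [zx _] := xz _ (kk _ jk).
  by rewrite (le_trans (g_linear Lxj yx zx))// ler_wpM2l// past.
- have [Lx0 _] := Lx 0%N; have Lxj := invariant_iter j fL Lx0.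
  have [_ yx] := xy _ (kk _ (ltnW jk)); have [_ zx] := xz _ (kk _ (ltnW jk)).
  by rewrite /= (le_trans (g_linear Lxj yx zx))// ler_wpM2l// future// ltnW.
- have E1 := ler_wpM2r W0 kP; have E2 := ler_wpM2r W0 dM.
  by rewrite exprS; rewrite -/W in E1 E2 *; rewrite /W in E1 E2 *; lra.
Qed.

End Tracking.

(** * The metric of the inverse limit *)

Section HatMetric.
Context {R : realType} {T : normedModType R}.
Implicit Types (x y : nat -> T) (A : set (nat -> T)).

Lemma hat_dist_coord x y (r : R) i : (hat_dist x y < r%:E)%E ->
  `|x i - y i| < 2 ^+ i * r.
Proof.
pose t j := (`|x j - y j| / 2 ^+ j)%:E.
have t0 j : (0 <= t j)%E by rewrite lee_fin mulr_ge0 ?invr_ge0 ?exprn_ge0.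
move=> xyr; rewrite mulrC -ltr_pdivrMr ?exprn_gt0// -lte_fin.
apply: le_lt_trans xyr; apply: le_trans (nneseries_lim_ge i.+1 _) => //.
by rewrite big_nat_recr//= leeDr// sume_ge0.
Qed.

Lemma hat_dist_le x y (D c : R) N : 0 <= D -> 0 <= c ->
  (forall i, `|x i - y i| <= D) -> (forall i, (i < N)%N -> `|x i - y i| <= c) ->
  (hat_dist x y <= (2 * c + 2 * D * 2^-1 ^+ N)%:E)%E.
Proof.
move=> D0 c0 xyD xyc.
have h0 n : 0 <= 2^-1 ^+ n :> R by rewrite exprn_ge0 ?invr_ge0.
pose t j : R := `|x j - y j| / 2 ^+ j.
have tE j : t j = `|x j - y j| * 2^-1 ^+ j by rewrite /t exprVn.
have head n : (n <= N)%N -> \sum_(0 <= j < n) t j <= 2 * c * (1 - 2^-1 ^+ n).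
  elim: n => [|n IH] nN; first by rewrite big_nil subrr mulr0.
  rewrite big_nat_recr//= (le_trans (lerD (IH (ltnW nN)) (_ : _ <= c * 2^-1 ^+
    n)))//.
    by rewrite tE ler_wpM2r// xyc.
  by rewrite exprS; lra.
have tail m : \sum_(0 <= j < N + m) t j <=
    2 * c + 2 * D * 2^-1 ^+ N * (1 - 2^-1 ^+ m).
  elim: m => [|m IH].
    rewrite addn0 subrr mulr0 addr0 (le_trans (head N (leqnn N)))//.
    by rewrite ler_piMr ?mulr_ge0// gerBl.
  rewrite addnS big_nat_recr//= (le_trans (lerD IH (_ : _ <= D * (2^-1 ^+ N *
    2^-1 ^+ m))))//.
    by rewrite tE exprD ler_wpM2r// mulr_ge0.
  by rewrite exprS; lra.
apply: lime_le; first by apply: is_cvg_nneseries => n _ _;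
  rewrite lee_fin mulr_ge0 ?invr_ge0 ?exprn_ge0.
apply: nearW => n; rewrite sumEFin lee_fin.
have [nN|/ltnW/subnKC <-] := leqP n N.
  rewrite (le_trans (head n nN))//.
  have a := mulr_ge0 c0 (h0 n); have b := mulr_ge0 D0 (h0 N); lra.
apply: (le_trans (tail _)).
have a := mulr_ge0 (mulr_ge0 D0 (h0 N)) (h0 (n - N)%N); lra.
Qed.

(** Neighbourhoods of [x] relative to [A], in the form in which they occur in
    [hat_continuous_map]. *)
Definition hat_near A x (P : (nat -> T) -> Prop) : Prop :=
  exists2 r : R, 0 < r & forall y, A y -> (hat_dist x y < r%:E)%E -> P y.

Lemma hat_nearS A x (P Q : (nat -> T) -> Prop) :
  (forall y, A y -> P y -> Q y) -> hat_near A x P -> hat_near A x Q.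
Proof. by move=> PQ [r r0 rP]; exists r => // y Ay xy; apply/PQ/rP. Qed.

Lemma hat_nearI A x (P Q : (nat -> T) -> Prop) :
  hat_near A x P -> hat_near A x Q -> hat_near A x (fun y => P y /\ Q y).
Proof.
move=> [r r0 rP] [s s0 sQ]; exists (Num.min r s); first by rewrite lt_min r0.
move=> y Ay; rewrite EFin_min lt_min => /andP[xr xs].
by split; [exact: rP|exact: sQ].
Qed.

Lemma hat_near_forall A x (P : nat -> (nat -> T) -> Prop) n :
  (forall j, (j < n)%N -> hat_near A x (P j)) ->
  hat_near A x (fun y => forall j, (j < n)%N -> P j y).
Proof.
elim: n => [|n IH] nP; first by exists 1.
have := hat_nearI (IH (fun j jn => nP j (ltnW jn))) (nP n (leqnn _)).
apply: hat_nearS => y _ [Py Pny] j; rewrite ltnS leq_eqVlt => /orP[/eqP ->//|].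
exact: Py.
Qed.

Lemma hat_near_continuous A x (h : T -> T) i (e : R) :
  {for x i, continuous h} -> 0 < e ->
  hat_near A x (fun y => `|h (y i) - h (x i)| < e).
Proof.
move=> hc e0; move/cvgrPdist_lt/(_ _ e0)/nbhs_ballP: hc => [r /= r0 rP].
exists (r / 2 ^+ i); first by rewrite divr_gt0// exprn_gt0.
move=> y _ /hat_dist_coord-/(_ i); rewrite mulrC divfK ?expf_neq0// => xy.
by rewrite distrC; apply: rP; rewrite -ball_normE.
Qed.

(** On bounded sets the metric induces the product topology. *)
Lemma hat_continuous_mapP A (F : (nat -> T) -> (nat -> T)) (D : R) :
  (forall x y i, A x -> A y -> `|F x i - F y i| <= D) ->
  (forall x i (e : R), A x -> 0 < e ->
     hat_near A x (fun y => `|F x i - F y i| < e)) ->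
  hat_continuous_map A F.
Proof.
move=> FD Fc x Ax e e0.
have D0 : 0 <= D := le_trans (normr_ge0 _) (FD x x 0%N Ax Ax).
have h1 : `|2^-1 : R| < 1 by rewrite ger0_norm ?invr_ge0// invf_lt1// ltr1n.
have e2 : 0 < e / 2 by rewrite divr_gt0.
have e4 : 0 < e / 4 by rewrite divr_gt0.
have [N _ /(_ N (leqnn N)) /= NP] := near_geometric_le (2 * D) h1 e2.
have := hat_near_forall (fun j (_ : (j < N)%N) => Fc x j _ Ax e4).
apply: hat_nearS => y Ay xy.
apply: le_lt_trans (hat_dist_le (N := N) D0 (ltW e4) _ _) _ => [i|i iN|].
- exact: FD.
- exact/ltW/xy.
- by rewrite lte_fin; lra.
Qed.

Variables (f : T -> T) (L : set T).
Hypotheses (fL : invariant_set f L) (fc : forall z, L z -> {for z,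
  continuous f}).

Lemma continuous_iter n z : L z -> {for z, continuous (iter n f)}.
Proof.
move=> Lz; elim: n => [|n IH]; first exact: cvg_id.
exact: (continuous_comp IH (fc (invariant_iter n fL Lz))).
Qed.

(** The metric compares pasts only; the future of [x i] depends continuously on
    [x i]. *)
Lemma hat_near_tracks x i m (e : R) : inverse_limit f L x -> 0 < e ->
  hat_near (inverse_limit f L) x (fun y =>
    tracks f f e m (iter i unshift x) (iter i unshift y)).
Proof.
move=> Lx e0; have idc (z : T) : {for z, continuous id} by exact: cvg_id.
have [Lxi _] := Lx i.
have := hat_near_forall (fun j (_ : (j < m.+1)%N) =>
  hat_nearI (hat_near_continuous (inverse_limit f L) (idc (x (i + j)%N)) e0)
            (hat_near_continuous (inverse_limit f L) (continuous_iter (n := j)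
              Lxi) e0)).
apply: hat_nearS => y Ay xy j jm; rewrite !iter_unshift addn0.
by have [] := xy j jm.
Qed.

End HatMetric.

(** * The conjugacy *)

Section Conjugacy.
Context {R : realType} {T : normedModType R}.
Hypothesis fdT : finite_dimensional T.
Variables (f g : T -> T) (L : set T) (S U : nat -> (nat -> T) -> T -> T).
Variables (q lam r d : R) (k : nat) (phi : (nat -> T) -> T).
Hypotheses (cL : compact L) (fL : invariant_set f L).
Hypothesis G : green_kernel f L S U q lam.
Hypotheses (r0 : 0 < r) (d0 : 0 <= d) (dM : d * green_norm q lam <= 4^-1).
Hypothesis kP : 2 * q * lam ^+ k <= 4^-1.
Hypothesis f_linear : forall x y z, L x -> `|y - x| < r -> `|z - x| < r ->
  `|f y - f z - 'd f x (y - z)| <= d * `|y - z|.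
Hypothesis g_linear : forall x y z, L x -> `|y - x| < r -> `|z - x| < r ->
  `|g y - g z - 'd f x (y - z)| <= d * `|y - z|.
Hypothesis f_cont : forall x, L x -> {for x, continuous f}.
Hypothesis g_cont : forall x y, L x -> `|y - x| < r -> {for y, continuous g}.
Hypothesis phi_near : forall x, inverse_limit f L x -> `|phi x - x 0%N| < r / 3.
Hypothesis phi_conj : forall x, inverse_limit f L x ->
  g (phi x) = phi (hat_shift f x).

Let hatL := inverse_limit f L.
Let sigma := hat_shift f.

Definition shadow_set : set T := phi @` hatL.
Definition conjugacy (x : nat -> T) : nat -> T := fun i => phi (iter i unshift
  x).

Let hatLg := inverse_limit g shadow_set.

Let r3 : 0 < r / 3. Proof. by rewrite divr_gt0. Qed.

Let limit_prehistory x : hatL x -> prehistory f x.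
Proof. by move=> Lx i; have [] := Lx i. Qed.

Let Lt n x : hatL x -> hatL (iter n unshift x).
Proof. exact: inverse_limit_iter_unshift. Qed.

Let Ls n x : hatL x -> hatL (iter n sigma x).
Proof. exact: inverse_limit_iter_shift. Qed.

Lemma shadow_set_invariant : invariant_set g shadow_set.
Proof.
apply/seteqP; split=> [_ [_ [x Lx <-] <-]|_ [x Lx <-]].
  by exists (sigma x); [exact: (Ls 1)|rewrite phi_conj].
exists (phi (unshift x)); first by exists (unshift x) => //; exact: (Lt 1).
by rewrite (phi_conj (Lt 1 Lx)) /= (unshiftK Lx).
Qed.

Lemma conjugacy_prehistory x : hatL x -> prehistory g (conjugacy x).
Proof.
move=> Lx i; rewrite /conjugacy (phi_conj (Lt i.+1 Lx)) /=.
by rewrite (unshiftK (Lt i Lx)).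
Qed.

Lemma conjugacy_inverse_limit x : hatL x -> hatLg (conjugacy x).
Proof.
move=> Lx i; split; last exact: conjugacy_prehistory.
by exists (iter i unshift x) => //; exact: Lt.
Qed.

Lemma conjugacy_unshift n x :
  iter n unshift (conjugacy x) = conjugacy (iter n unshift x).
Proof.
by apply/funext => i; rewrite iter_unshift /conjugacy -iterD addnC.
Qed.

Lemma iter_phi n x : hatL x -> iter n g (phi x) = phi (iter n sigma x).
Proof.
by move=> Lx; elim: n => //= n ->; rewrite phi_conj//; exact: Ls.
Qed.

Lemma conjugacy_shift x : hatL x -> hat_shift g (conjugacy x) = conjugacy
  (sigma x).
Proof.
move=> Lx; apply/funext => -[|i]; first exact: phi_conj.
by rewrite /conjugacy iterSr hat_shiftK.
Qed.

Lemma shadow_close x j : hatL x ->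
  `|conjugacy x j - x j| < r / 3 /\
  `|iter j g (conjugacy x 0%N) - iter j f (x 0%N)| < r / 3.
Proof.
move=> Lx; split.
  by have := phi_near (Lt j Lx); rewrite iter_unshift addn0.
by rewrite iter_phi// -iter_hat_shift0; exact/phi_near/Ls.
Qed.

Lemma conjugacy_tracks m x y : hatL x -> hatL y ->
  tracks f f (r / 3) m x y -> tracks f g r m x (conjugacy y).
Proof.
move=> Lx Ly xy j jm; have [a b] := xy j jm; have [c e] := shadow_close j Ly.
split.
  rewrite (le_lt_trans (ler_distD (y j) _ _))// (lt_trans (ltrD c a))//.
  by move: r3; lra.
rewrite (le_lt_trans (ler_distD (iter j f (y 0%N)) _ _))// (lt_trans (ltrD e
  b))//.
by move: r3; lra.
Qed.

Let tracks_refl (h : T -> T) m (x : nat -> T) : tracks h h (r / 3) m x x.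
Proof. by move=> j _; rewrite !subrr normr0. Qed.

Lemma conjugacy_contraction J x y : hatL x -> hatL y ->
  tracks f f (r / 3) (J * k) x y -> `|phi x - phi y| <= 2 * r * 2^-1 ^+ J.
Proof.
move=> Lx Ly xy.
apply: (tracking_contraction fL G d0 dM kP g_linear Lx
  (conjugacy_prehistory Lx) (conjugacy_prehistory Ly)).
  exact: (conjugacy_tracks Lx Lx).
exact: conjugacy_tracks.
Qed.

(** The orbits of [x] and [y] are both orbits of [f] that follow [x], so the
    contraction estimate applies with [g] replaced by [f].  The window of [y]
    around [x] is crossed in three steps below [r / 3]: from [x] to its
    conjugate, to the conjugate of [y], to [y]. *)
Lemma conjugacy_expansive J x y : hatL x -> hatL y ->
  tracks g g (r / 3) (J * k) (conjugacy x) (conjugacy y) ->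
  `|x 0%N - y 0%N| <= 2 * r * 2^-1 ^+ J.
Proof.
move=> Lx Ly xy.
apply: (tracking_contraction fL G d0 dM kP f_linear Lx
  (limit_prehistory Lx) (limit_prehistory Ly)).
  by move=> j _; rewrite !subrr normr0.
move=> j jm; have [a b] := xy j jm.
have [c e] := shadow_close j Lx; have [c' e'] := shadow_close j Ly.
rewrite distrC in c'; rewrite distrC in e'.
split.
  rewrite (le_lt_trans (ler_distD (conjugacy y j) _ _))//.
  have h := le_lt_trans (ler_distD (conjugacy x j) _ _) (ltrD a c).
  by rewrite (lt_le_trans (ltrD c' h))//; lra.
rewrite (le_lt_trans (ler_distD (iter j g (conjugacy y 0%N)) _ _))//.
have h := le_lt_trans (ler_distD (iter j g (conjugacy x 0%N)) _ _) (ltrD b e).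
by rewrite (lt_le_trans (ltrD e' h))//; lra.
Qed.

Let half_lt1 : `|2^-1 : R| < 1.
Proof. by rewrite ger0_norm ?invr_ge0// invf_lt1// ltr1n. Qed.

Let window (e : R) : 0 < e -> exists J, 2 * r * 2^-1 ^+ J < e.
Proof.
move=> e0; have [J _ JP] := near_geometric_le (2 * r) half_lt1 e0.
by exists J; exact: (JP J (leqnn J)).
Qed.

Let eq_of_contraction (v w : T) :
  (forall J, `|v - w| <= 2 * r * 2^-1 ^+ J) -> v = w.
Proof.
move=> vw; apply/eqP; rewrite -subr_eq0 -normr_le0.
apply/ler_addgt0Pr => e /window[J Je]; rewrite add0r.
exact: le_trans (vw J) (ltW Je).
Qed.

Lemma conjugacy_inj x y : hatL x -> hatL y -> conjugacy x = conjugacy y -> x =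
  y.
Proof.
move=> Lx Ly xy; apply/funext => i; apply: eq_of_contraction => J.
have := @conjugacy_expansive J _ _ (Lt i Lx) (Lt i Ly).
rewrite -!conjugacy_unshift xy !iter_unshift addn0; apply; exact: tracks_refl.
Qed.

(** Each point [y i] is [phi (xs i)], with prehistories [xs i] unrelated to each
    other.  Shifting [xs i] forward to time 0 gives [z i], whose conjugate
    agrees with [y] up to time [i].  Conjugates of [z i] and [z i'] therefore
    agree on long windows, and expansivity makes [z] converge coordinatewise. *)
Lemma conjugacy_surj y : hatLg y -> exists2 x, hatL x & conjugacy x = y.
Proof.
move=> Ly; have gy : prehistory g y by move=> i; have [] := Ly i.
have [i|xs xsP] := @choice nat (nat -> T) (fun i x => hatL x /\ phi x = y i).
  by have [[x Lx <-] _] := Ly i; exists x.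
pose z i := iter i sigma (xs i).
have Lz i : hatL (z i) by apply: Ls; have [] := xsP i.
have uK n x : iter n unshift (iter n sigma x) = x.
  by elim: n x => // n IH x; rewrite iterSr iterS hat_shiftK.
have zy i j : (j <= i)%N -> conjugacy (z i) j = y j.
  move=> ji; have [Lxi phixi] := xsP i.
  have e : iter j unshift (z i) = iter (i - j) sigma (xs i).
    by rewrite /z -[X in iter j unshift (iter X _ _)](subnKC ji) iterD uK.
  rewrite /conjugacy e -iter_phi// phixi -[i in y i](subnK ji).
  exact: iter_prehistory.
have window_eq i i' j m : (j + m <= i)%N -> (j + m <= i')%N ->
    tracks g g (r / 3) m (conjugacy (iter j unshift (z i)))
      (conjugacy (iter j unshift (z i'))).
  move=> ji ji' l lm; rewrite -!conjugacy_unshift !iter_unshift addn0.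
  have jl : (j + l <= j + m)%N by rewrite leq_add2l.
  have j0 := leq_addr m j.
  rewrite !zy ?subrr ?normr0 ?(leq_trans jl) ?(leq_trans j0)//.
have zc j : cvg ((fun i => z i j) @ \oo).
  apply: (cauchy_sequence_cvg fdT) => e /window[J Je].
  exists (j + J * k)%N => n jn.
  have := @conjugacy_expansive J _ _ (Lt j (Lz (j + J * k)%N)) (Lt j (Lz n))
    (window_eq _ _ j _ (leqnn _) jn).
  by rewrite !iter_unshift addn0 => h; exact: le_lt_trans h Je.
pose w j := lim ((fun i => z i j) @ \oo).
have zw j : (fun i => z i j) @ \oo --> w j by exact: zc.
have Lw : hatL w.
  move=> j.
  have Lwj n : L (w n).
    apply: (closed_cvg L _ _ _ (zw n)).
      by apply: compact_closed => //; exact: norm_hausdorff.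
    by apply: nearW => i; have [] := Lz i n.
  split=> //; apply: (cvg_unique (@norm_hausdorff _ T) _ (zw j)).
  have -> : (fun i => z i j) = f \o (fun i => z i j.+1).
    by apply/funext => i /=; have [] := Lz i j.
  exact: (continuous_cvg _ (f_cont (Lwj j.+1)) (zw j.+1)).
exists w => //; apply/funext => j; apply: eq_of_contraction => J.
have Lwj := Lw j.
have near_track : \forall i \near \oo,
    tracks f f (r / 3) (J * k) (iter j unshift w) (iter j unshift (z i)).
  have : \forall i \near \oo, forall l : 'I_(J * k).+1,
      `|w (j + l)%N - z i (j + l)%N| < r / 3 /\
      `|iter l f (w j) - iter l f (z i j)| < r / 3.
    apply: filter_forall => l; apply: filterI.
      by have := zw (j + l)%N; move/cvgrPdist_lt/(_ _ r3).
    have c : (fun i => iter l f (z i j)) @ \oo --> iter l f (w j).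
      exact: (continuous_cvg _ (continuous_iter fL f_cont (n := l) Lwj.1) (zw
        j)).
    by move/cvgrPdist_lt/(_ _ r3): c.
  apply: filterS => i iP l lm; have [a b] := iP (Ordinal (lm : l < (J *
    k).+1)%N).
  by rewrite !iter_unshift addn0 distrC [X in _ /\ X < _]distrC.
have [i [ji ti]] := filter_ex (filterI (nbhs_infty_ge j) near_track).
by rewrite -(zy i j ji); exact: (conjugacy_contraction (Lt j Lw) (Lt j (Lz i))).
Qed.

Let L_bounded : exists2 B : R, 0 <= B & forall v, L v -> `|v| <= B.
Proof.
have [B [_ BP]] := compact_bounded cL.
exists (Num.max B 0 + 1); first by rewrite addr_ge0// le_max lexx orbT.
move=> v Lv; apply: BP Lv.
by rewrite (le_lt_trans (_ : _ <= Num.max B 0))// ?le_max ?lexx// ltrDl.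
Qed.

Lemma conjugacy_homeomorphism : hat_homeomorphism hatL hatLg conjugacy.
Proof.
have [y|K KP] := @choice (nat -> T) (nat -> T)
    (fun y x => hatLg y -> hatL x /\ conjugacy x = y).
  have [Ly|nLy] := pselect (hatLg y); last by exists y.
  by have [x Lx xy] := conjugacy_surj Ly; exists x.
have [B B0 BP] := L_bounded.
have LB x y i : hatL x -> hatL y -> `|x i - y i| <= 2 * B.
  move=> Lx Ly; rewrite (le_trans (ler_normB _ _))// mulr_natl mulr2n.
  by rewrite lerD// BP//; [have [] := Lx i|have [] := Ly i].
exists K; split=> //.
- move=> x Lx; have LHx := conjugacy_inverse_limit Lx; split=> //.
  by have [LK KE] := KP _ LHx; exact: conjugacy_inj.
- apply: (hat_continuous_mapP (D := 2 * B + r)) => [x y i Lx Ly|x i e Lx e0].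
    have [a _] := shadow_close i Lx; have [b _] := shadow_close i Ly.
    rewrite distrC in b.
    rewrite (le_trans (ler_distD (x i) _ _))//.
    have h := le_trans (ler_distD (y i) _ _) (lerD (LB x y i Lx Ly) (ltW b)).
    by rewrite (le_trans (lerD (ltW a) h))//; move: r3; lra.
  have [J Je] := window e0.
  apply: hat_nearS (hat_near_tracks fL f_cont i (J * k) Lx r3) => y Ly xy.
  exact: le_lt_trans (conjugacy_contraction (Lt i Lx) (Lt i Ly) xy) Je.
- apply: (hat_continuous_mapP (D := 2 * B)) => [x y i /KP[Lx _] /KP[Ly _]|x i e
  Lx e0].
    exact: LB.
  have [J Je] := window e0.
  have gc v : shadow_set v -> {for v, continuous g}.
    move=> [z Lz <-]; have [Lz0 _] := Lz 0%N; apply: (g_cont Lz0).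
    by rewrite (lt_trans (phi_near Lz))//; move: r3; lra.
  apply: hat_nearS (hat_near_tracks shadow_set_invariant gc i (J * k) Lx r3) =>
    y Ly xy.
  have [LKx KxE] := KP x Lx; have [LKy KyE] := KP y Ly.
  rewrite -KxE -KyE !conjugacy_unshift in xy.
  have := conjugacy_expansive (Lt i LKx) (Lt i LKy) xy.
  by rewrite !iter_unshift addn0 => h; exact: le_lt_trans h Je.
Qed.

End Conjugacy.

(** * Stability of hyperbolic sets *)

Theorem hyperbolic_inverse_limit_stability (R : realType) (T : normedModType R)
    (fdT : finite_dimensional T) (f : T -> T) (L U : set T) :
  hyperbolic_set f L -> open U -> L `<=` U -> C2_on U f ->
  exists2 e : R, 0 < e & forall g : T -> T, C2_on U g -> C2_close U e f g ->
    exists Lg : set T, [/\ Lg `<=` U, invariant_set g Lg &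
      exists H : (nat -> T) -> (nat -> T),
        hat_homeomorphism (inverse_limit f L) (inverse_limit g Lg) H /\
        forall x, inverse_limit f L x ->
          hat_shift g (H x) = H (hat_shift f x)].
Proof.
move=> [cL fL _ [Es [Eu hyp]]] oU LU fU.
have df y : L y -> differentiable f y by move=> /LU/fU[].
have [B B0 fB] := diff_bounded fdT cL LU fU.
have [S [V [q [lam G]]]] := hyperbolic_green_kernel fL df hyp B0 fB.
pose M := green_norm q lam; have M0 : 0 < M := green_norm_gt0 G.
have [k kP] : exists k, 2 * q * lam ^+ k <= 4^-1.
  have /andP[l0 l1] := green_rate G.
  have l1' : `|lam| < 1 by rewrite gtr0_norm.
  have h4 : 0 < 4^-1 :> R by rewrite invr_gt0.
  have [k _ kP] := near_geometric_le (2 * q) l1' h4.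
  by exists k; exact/ltW/(kP k (leqnn k)).
pose d := 4^-1 / M; have d0 : 0 < d by rewrite divr_gt0// invr_gt0.
have dM : d * M <= 4^-1 by rewrite /d divfK// gt_eqF.
have [r r0 [rU [e1 e10 e1P]]] := local_linear_estimate fdT cL oU LU fU d0.
have M12 : 0 < 12 * M by apply: mulr_gt0.
(* [phi x] has to be within [r / 3] of [x 0], and Newton's method moves by at
   most [2 * M * e]. *)
have r12 : 0 < r / (12 * M) by apply: divr_gt0.
exists (Num.min e1 (r / (12 * M))); first by rewrite lt_min e10.
set e := Num.min _ _ => g gU fg.
have e0 : 0 < e by rewrite lt_min e10.
have eM : 2 * M * e < r / 3.
  have : e <= r / (12 * M) by rewrite ge_min lexx orbT.
  by rewrite (ler_pdivlMr _ _ M12) => h; lra.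
have g_lin x y z : L x -> `|y - x| < r -> `|z - x| < r ->
    `|g y - g z - 'd f x (y - z)| <= d * `|y - z|.
  apply: e1P => w Uw; have [dg _ _] := gU w Uw; have [_ dfg _] := fg w Uw.
  split=> // v; rewrite (le_trans (dfg v))// ler_wpM2r// ge_min lexx//.
have f_lin' x y z : L x -> `|y - x| < r -> `|z - x| < r ->
    `|f y - f z - 'd f x (y - z)| <= d * `|y - z|.
  apply: e1P => w Uw; have [dfw _ _] := fU w Uw.
  by split=> // v; rewrite subrr normr0 mulr_ge0// ltW.
have g_cont x y : L x -> `|y - x| < r -> {for y, continuous g}.
  by move=> Lx /(rU _ _ Lx)/gU[/differentiable_continuous].
have f_cont x : L x -> {for x, continuous f}.
  by move=> /df/differentiable_continuous.
have g_close x : L x -> `|f x - g x| <= e by move=> /LU/fg[].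
have eMr : 2 * M * e < r by lra.
have [phi phiP] := shadowing_map fdT fL G (ltW e0) (ltW d0) dM eMr g_lin g_cont
  g_close.
have phi_near x : inverse_limit f L x -> `|phi x - x 0%N| < r / 3.
  by move=> /phiP[h _]; exact: le_lt_trans h eM.
have phi_conj x : inverse_limit f L x -> g (phi x) = phi (hat_shift f x).
  by move=> /phiP[].
exists (shadow_set f L phi); split.
- move=> _ [x Lx <-]; have [Lx0 _] := Lx 0%N; apply: (rU _ _ Lx0).
  by rewrite (lt_trans (phi_near x Lx))//; lra.
- exact: (shadow_set_invariant fL phi_conj).
- exists (conjugacy phi); split; last by move=> x Lx;
  exact: (conjugacy_shift phi_conj).
  exact: (conjugacy_homeomorphism fdT cL fL G r0 (ltW d0) dM kP f_lin' g_lin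
    f_cont g_cont phi_near phi_conj).
Qed.

Theorem theorem1 (R : realType) (m : economic_model)
    (f : state R m -> state R m) (hf : model_maps R m f)
    (L : set (state R m)) (hL : hyperbolic_set f L)
    (U : set (state R m)) (openU : open U) (LU : L `<=` U)
    (UD : U `<=` model_domain R m) (fU : C2_on U f) :
  exists2 e : R, 0 < e &
    forall g : state R m -> state R m,
      model_maps R m g -> C2_on U g -> C2_close U e f g ->
      exists Lg : set (state R m),
        [/\ Lg `<=` model_domain R m,
            invariant_set g Lg &
            exists H : (nat -> state R m) -> (nat -> state R m),
              hat_homeomorphism (inverse_limit f L) (inverse_limit g Lg) H /\
              forall x, inverse_limit f L x ->
                hat_shift g (H x) = H (hat_shift f x)].
Proof.
have fd : finite_dimensional (state R m).
  by case: m {f hf L hL U openU LU UD fU};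
    [exact: finite_dimensional_line|exact: finite_dimensional_plane
    |exact: finite_dimensional_line|exact: finite_dimensional_line
    |exact: finite_dimensional_plane].
have [e e0 eP] := hyperbolic_inverse_limit_stability fd hL openU LU fU.
exists e => // g _ gU fg; have [Lg [LgU gLg conj]] := eP g gU fg.
by exists Lg; split=> //; exact: subset_trans UD.
Qed.
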